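(* Let $f$ and $g$ be polynomials with complex coefficients, each of degree greater than or equal to two, and let $G=\langle f,g\rangle$. If $J_f\neq J_g$, then $E(G)=\overline{\mathbb C}$.
   Context: $\overline{\mathbb C}$ is the Riemann sphere with the spherical metric; polynomials are regarded as rational maps $\overline{\mathbb C}\to\overline{\mathbb C}$. A rational semigroup is a semigroup, under composition, of rational functions of degree at least two on $\overline{\mathbb C}$; $\langle f,g\rangle$ denotes the semigroup generated by $f$ and $g$ (all finite nonempty compositions of $f$'s and $g$'s). For a rational function $h$ of degree at least two, $J_h$ is its Julia set: the complement in $\overline{\mathbb C}$ of the set of points having a neighborhood on which the family of iterates $\{h^n:n\ge1\}$ is normal. A set $X\subset\overline{\mathbb C}$ is completely invariant under $h$ if $h(X)\subset X$ and $h^{-1}(X)\subset X$. For a rational semigroup $G$, $$E(G)=\bigcap\{S\subset\overline{\mathbb C}: S\text{ is closed, completely invariant under each } g\in G,\ \#(S)\ge 3\},$$ where $\#(S)$ is the cardinality of $S$. *)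

(* Defs.v *)
From HB Require Import structures.
From mathcomp Require Import all_boot all_order all_algebra.
From mathcomp Require Import all_classical all_reals all_analysis.
From mathcomp Require Import complex.
From mathcomp Require Import ring lra.
Set Implicit Arguments.
Unset Strict Implicit.
Unset Printing Implicit Defensive.
Import Order.TTheory GRing.Theory Num.Theory.
Import numFieldNormedType.Exports.
Local Open Scope classical_set_scope.
Local Open Scope ring_scope.

(* [None] is the point at infinity. *)
Definition riemann_sphere (R : realType) : Type := option R[i].

HB.instance Definition _ (R : realType) := Choice.on (riemann_sphere R).

Section SphericalMetric.
Context {R : realType}.
Local Notation S := (riemann_sphere R).
Local Notation normc := ComplexField.Normc.normc.

(* Half the Euclidean distance between the images of [p] and [q] under
   stereographic projection onto the unit sphere of R^3. *)
Definition half_chord (p q : S) : R :=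
  match p, q with
  | Some z, Some w => normc (z - w) /
      (Num.sqrt (1 + normc z ^+ 2) * Num.sqrt (1 + normc w ^+ 2))
  | Some z, None | None, Some z => (Num.sqrt (1 + normc z ^+ 2))^-1
  | None, None => 0
  end.

(* Great-circle distance on the unit sphere, i.e. the distance of the
   Riemannian metric 2|dz| / (1 + |z|^2). *)
Definition spherical_dist (p q : S) : R := 2 * asin (half_chord p q).

(* The metric axioms are checked in homogeneous coordinates. *)
Let hx (p : S) : R[i] := if p is Some z then z else 1.
Let hy (p : S) : R[i] := if p is Some z then 1 else 0.
Let hn (p : S) : R := Num.sqrt (normc (hx p) ^+ 2 + normc (hy p) ^+ 2).
Let hdet (p q : S) : R[i] := hx p * hy q - hy p * hx q.
Let hdot (p q : S) : R[i] := hx p * (hx q)^*%C + hy p * (hy q)^*%C.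
Let half_cos (p q : S) : R := normc (hdot p q) / (hn p * hn q).

Let normc_ge0 (z : R[i]) : 0 <= normc z.
Proof. by case: z => a b; exact: sqrtr_ge0. Qed.

Let normc0 : normc (0 : R[i]) = 0.
Proof. exact: ComplexField.Normc.normc0. Qed.

Let normc1 : normc (1 : R[i]) = 1.
Proof. exact: ComplexField.Normc.normc1. Qed.

Let normcN (z : R[i]) : normc (- z) = normc z.
Proof. exact: (@complex.normcN R). Qed.

Let normc2 (a b : R) : normc (a +i* b)%C ^+ 2 = a ^+ 2 + b ^+ 2.
Proof. by rewrite sqr_sqrtr // addr_ge0 ?sqr_ge0. Qed.

Let normcJ' (z : R[i]) : normc z^*%C = normc z.
Proof. by case: z => a b /=; rewrite sqrrN. Qed.

Local Arguments ComplexField.Normc.normc _ _ : simpl never.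

Let hn_gt0 p : 0 < hn p.
Proof.
rewrite sqrtr_gt0; case: p => [z|] /=.
  by rewrite normc1 expr1n ltr_wpDl ?sqr_ge0.
by rewrite normc1 expr1n ltr_wpDr ?sqr_ge0.
Qed.

Let half_chordE p q : half_chord p q = normc (hdet p q) / (hn p * hn q).
Proof.
case: p q => [z|] [w|]; rewrite /half_chord /hdet /hn /=.
- by rewrite mulr1 mul1r normc1 expr1n ![_ + 1]addrC.
- by rewrite !(mulr0, mulr1, sub0r, normcN) normc1 normc0 expr1n
    expr0n /= addr0 sqrtr1 mulr1 mul1r addrC.
- by rewrite !(mul0r, mulr1, subr0) normc1 normc0 expr1n
    expr0n /= addr0 sqrtr1 !mul1r addrC.
- by rewrite mulr0 mul0r subr0 normc0 mul0r.
Qed.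

Let lagrange p q :
  normc (hdet p q) ^+ 2 + normc (hdot p q) ^+ 2 = hn p ^+ 2 * hn q ^+ 2.
Proof.
rewrite !sqr_sqrtr ?addr_ge0 ?sqr_ge0 // /hdet /hdot.
case: (hx p) (hy p) (hx q) (hy q) => [a b] [c d] [e f] [g h].
by simpc; rewrite !normc2; ring.
Qed.

Let trig p q : half_chord p q ^+ 2 + half_cos p q ^+ 2 = 1.
Proof.
have np := hn_gt0 p; have nq := hn_gt0 q.
rewrite half_chordE /half_cos !expr_div_n -mulrDl lagrange -exprMn divff //.
by rewrite expf_neq0 // mulf_neq0 ?gt_eqF.
Qed.

Let half_chord_ge0 p q : 0 <= half_chord p q.
Proof. by rewrite half_chordE divr_ge0 // mulr_ge0 // ltW. Qed.

Let half_cos_ge0 p q : 0 <= half_cos p q.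
Proof. by rewrite divr_ge0 // mulr_ge0 // ltW. Qed.

Let half_chord_le1 p q : half_chord p q <= 1.
Proof.
by rewrite -(@expr_le1 _ 2) // -(trig p q) lerDl sqr_ge0.
Qed.

Let half_chordB p q : -1 <= half_chord p q <= 1.
Proof. by rewrite half_chord_le1 andbT (le_trans _ (half_chord_ge0 _ _)) ?oppr_le0. Qed.

Let sin_asin p q : sin (asin (half_chord p q)) = half_chord p q.
Proof. by rewrite asinK // in_itv /= half_chordB. Qed.

Let cos_asin' p q : cos (asin (half_chord p q)) = half_cos p q.
Proof.
rewrite cos_asin ?half_chordB //; have := trig p q => /(canRL (addKr _)).
by rewrite addrC => <-; rewrite sqrtr_sqr ger0_norm.
Qed.

Let half_chord_sym p q : half_chord p q = half_chord q p.
Proof.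
rewrite !half_chordE (mulrC (hn p)) -(normcN (hdet q p)).
by congr (normc _ / _); rewrite /hdet; ring.
Qed.

Let half_cos_sym p q : half_cos p q = half_cos q p.
Proof.
rewrite /half_cos (mulrC (hn p)) -(normcJ' (hdot q p)).
congr (normc _ / _); rewrite /hdot.
case: (hx p) (hy p) (hx q) (hy q) => [a b] [c d] [e f] [g h].
by simpc; congr (_ +i* _)%C; ring.
Qed.

Let half_chord_triangle v p q : half_chord p q <=
  half_chord p v * half_cos v q + half_cos p v * half_chord v q.
Proof.
have np := hn_gt0 p; have nq := hn_gt0 q; have nv := hn_gt0 v.
rewrite (half_cos_sym v q) !half_chordE /half_cos.
have E : hdet p q * ((hn v ^+ 2)%:C)%C = hdet p v * hdot q v + hdot p v * hdet v q.
  rewrite sqr_sqrtr ?addr_ge0 ?sqr_ge0 // /hdet /hdot.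
  case: (hx p) (hy p) (hx q) (hy q) (hx v) (hy v)
    => [a b] [c d] [e f] [g h] [i j] [k l].
  by rewrite !normc2; simpc; congr (_ +i* _)%C; ring.
have nE : normc (((hn v ^+ 2)%:C)%C) = hn v ^+ 2.
  rewrite -[LHS]/(Num.sqrt ((hn v ^+ 2) ^+ 2 + 0 ^+ 2)).
  by rewrite expr0n /= addr0 sqrtr_sqr ger0_norm ?sqr_ge0.
have := @complex.le_normcD R (hdet p v * hdot q v) (hdot p v * hdet v q).
rewrite -E !ComplexField.Normc.normcM nE.
set A := normc _; set B := normc _; set C := normc _; set D := normc _.
set F := normc _ => H.
have -> : B / (hn p * hn v) * (C / (hn q * hn v)) + D / (hn p * hn v) * (F / (hn v * hn q)) =
  (B * C + D * F) / (hn v ^+ 2) / (hn p * hn q).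
  by field; rewrite !gt_eqF.
rewrite ler_pM2r ?invr_gt0 ?mulr_gt0 //.
by rewrite ler_pdivlMr ?exprn_gt0.
Qed.

Let asin_ge0 p q : 0 <= asin (half_chord p q).
Proof.
rewrite leNgt; apply/negP => a0.
have := half_chord_ge0 p q; rewrite -sin_asin leNgt => /negP; apply.
rewrite -[sin _]opprK -sinN oppr_lt0; apply: sin_gt0_pi.
rewrite oppr_gt0 a0 /=.
by have := asin_geNpi2 (half_chordB p q); have := pi_gt0 R; lra.
Qed.

Let spherical_distxx p : spherical_dist p p = 0.
Proof.
rewrite /spherical_dist half_chordE /hdet (mulrC (hy p)) subrr.
suff asin0 : asin (0 : R) = 0 by rewrite normc0 mul0r asin0 mulr0.
rewrite -[in LHS](@sin0 R) sinK // in_itv /=.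
by have := pi_gt0 R; lra.
Qed.

Let spherical_dist_eq0 p q : spherical_dist p q = 0 -> p = q.
Proof.
move=> /eqP; rewrite mulf_eq0 pnatr_eq0 /= => /eqP a0.
have := sin_asin p q; rewrite a0 sin0 half_chordE => /esym/eqP.
rewrite mulf_eq0 invr_eq0 mulf_eq0 !(gt_eqF (hn_gt0 _)) !orbF => /eqP.
move=> /ComplexField.Normc.eq0_normc; rewrite /hdet.
case: p q {a0} => [z|] [w|] //=.
- by rewrite mulr1 mul1r => /subr0_eq ->.
- by rewrite mulr0 mul1r sub0r => /eqP; rewrite oppr_eq0 oner_eq0.
- by rewrite mulr1 mul0r subr0 => /eqP; rewrite oner_eq0.
Qed.

Let spherical_dist_sym p q : spherical_dist p q = spherical_dist q p.
Proof. by rewrite /spherical_dist half_chord_sym. Qed.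

Let spherical_dist_triangle v p q :
  spherical_dist p q <= spherical_dist p v + spherical_dist v q.
Proof.
rewrite /spherical_dist -mulrDr ler_pM2l //.
have [ab|ab] := leP (pi / 2) (asin (half_chord p v) + asin (half_chord v q)).
  by rewrite (le_trans _ ab) // asin_lepi2 ?half_chordB.
have a0 := asin_ge0 p v; have b0 := asin_ge0 v q.
have pi0 := pi_gt0 R.
set a := asin _ in a0 ab *; set b := asin _ in b0 ab *.
rewrite leNgt; apply/negP => abc.
suff : sin (a + b) < half_chord p q.
  by rewrite ltNge sinD !sin_asin !cos_asin' half_chord_triangle.
have c1 := asin_lepi2 (half_chordB p q).
rewrite -(sin_asin p q) ltr_sin // in_itv /=; lra.
Qed.

HB.instance Definition _ := @isMetric.Build R S spherical_dist
  spherical_distxx spherical_dist_eq0 spherical_dist_sym spherical_dist_triangle.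

End SphericalMetric.

Section Dynamics.
Context {R : realType}.
Local Notation S := (riemann_sphere R).

(* A nonconstant polynomial, as a rational map, fixes the point at infinity. *)
Definition poly_map (p : {poly R[i]}) (z : S) : S :=
  match z with
  | Some w => Some p.[w]
  | None => if (1 < size p)%N then None else Some p`_0
  end.

(* Every sequence in [F] has a subsequence converging locally uniformly on [U]
   for the spherical metric. *)
Definition normal_family (U : set S) (F : set (S -> S)) : Prop :=
  forall u : nat -> S -> S, (forall n, F (u n)) ->
  exists2 k : nat -> nat, {homo k : m n / (m < n)%N} &
  exists l : S -> S, forall x, U x ->
    exists2 V, nbhs x V & {uniform V, (u \o k) @ \oo --> l}.

Definition iterates (h : S -> S) : set (S -> S) :=
  [set phi | exists2 n, (0 < n)%N & phi = iter n h].

Definition fatou_set (h : S -> S) : set S :=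
  [set x | exists2 U, open_nbhs x U & normal_family U (iterates h)].

Definition julia_set (h : S -> S) : set S := ~` fatou_set h.

Definition completely_invariant (h : S -> S) (X : set S) : Prop :=
  h @` X `<=` X /\ h @^-1` X `<=` X.

Inductive generated_semigroup (A : set (S -> S)) : set (S -> S) :=
  | gen_base h : A h -> generated_semigroup A h
  | gen_comp h1 h2 : generated_semigroup A h1 -> generated_semigroup A h2 ->
      generated_semigroup A (h1 \o h2).

Definition E_set (G : set (S -> S)) : set S :=
  \bigcap_(X in [set X : set S | [/\ closed X,
    forall g, G g -> completely_invariant g X & (`I_3 #<= X)%card]]) X.

End Dynamics.

(* Main.v *)
From HB Require Import structures.
Require Import Defs.
From mathcomp Require Import all_boot all_order all_algebra.
From mathcomp Require Import all_classical all_reals all_analysis.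
From mathcomp Require Import complex ring lra.

(** Let [X] be a closed set with at least three points, completely invariant
    under [f] and [g]. A point outside [X] forces [J_f = J_g], for the following
    reason.

    Let [K_f] be the filled Julia set and [G_f] the Green function [green f],
    i.e. the escape rate [lim d^-n ln (1 + |f^n|)]; then [G_f (f z) = d G_f z]
    and [K_f] is the zero set of [G_f]. Near a boundary point of [K_f], or near
    a point of level [t > 0] of [G_f], the iterates [f^n] cannot omit two values
    that are well separated at the scale [exp (d^n t)] ([orbit_hits]). This is
    the part of Montel's theorem that the argument needs. It holds for the
    following reason ([two_values]). If [p] and [p - k], of large degree [D],
    have no zero in a disc, then, where [|p|] is comparable to [|k|], the slope
    of [ln |p|] is of order [sqrt D] at most, because [(ln p)''] and
    [(ln (p - k))''] are of order [D] at most. On the other hand, if [|p|]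
    varies in the disc from [|k|] to [|k| B^D] with [B > 1], then Hopf's lemma
    gives a point where [|p|] is comparable to [|k|] and the slope is of
    order [D].

    Both [X] and its complement contain two finite points. Hence both accumulate
    at every boundary point of [K_f] ([boundary_hits]), and outside [K_f] the
    closed set [X] is a union of level sets of [G_f] ([level_saturated]).

    Now compare [P = f^n o g] and [Q = g o f^n], which have the same degree. If
    for every [n] they differ by a Euclidean isometry, [P = u Q + c] with
    [|u| = 1], then [c] is bounded in [n], so [g] maps [K_f] into itself and
    [K_f] is contained in [K_g] ([filled_of_commuting]). Otherwise, on some ray,
    one of [|P|], [|Q|] exceeds the other by a quantity that tends to infinity
    ([ray_dichotomy]); since [G_f - ln |.|] is a constant up to [O(1/|.|)], the
    difference of [G_f o P] and [G_f o Q] on this ray is bounded and does not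
    vanish. As [z], [P z] and [Q z] belong to [X] together, a level [d^n t] of
    [G_f] in [X] is followed by another one at bounded distance, and after
    division by [d^n] the set [X] has levels just above [t]. Therefore the basin
    of infinity of [f] lies in [X] or in the complement of [X]
    ([all_or_nothing]), and so does that of [g].

    Let [Y] be the one of these two sets that contains the basins. A boundary
    point of [K_f] is a limit of points outside [Y], so it does not lie in the
    basin of [g], and the maximum principle for [G_g] on [K_f] shows that [K_f]
    is contained in [K_g] ([filled_le]). By symmetry [K_f = K_g] in all cases
    ([filled_julia_eq]). Finally [J_f] is the boundary of [K_f]
    ([julia_setE]). *)

Set Implicit Arguments.
Unset Strict Implicit.
Unset Printing Implicit Defensive.
Import Order.TTheory GRing.Theory Num.Theory.
Import numFieldNormedType.Exports.
Local Open Scope classical_set_scope.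
Local Open Scope ring_scope.

(** * The modulus of a complex number *)

Notation nc := ComplexField.Normc.normc.
Arguments ComplexField.Normc.normc _ _ : simpl never.

Section Modulus.
Context {R : realType}.
Implicit Types z w : R[i].

Lemma nc_ge0 z : 0 <= nc z.
Proof. by case: z => a b; exact: sqrtr_ge0. Qed.

Lemma nc0 : nc (0 : R[i]) = 0.
Proof. exact: ComplexField.Normc.normc0. Qed.

Lemma nc1 : nc (1 : R[i]) = 1.
Proof. exact: ComplexField.Normc.normc1. Qed.

Lemma ncM z w : nc (z * w) = nc z * nc w.
Proof. exact: ComplexField.Normc.normcM. Qed.

Lemma ncN z : nc (- z) = nc z.
Proof. exact: (@complex.normcN R). Qed.

Lemma ncV z : nc z^-1 = (nc z)^-1.
Proof. exact: ComplexField.Normc.normcV. Qed.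

Lemma nc_triangle z w : nc (z + w) <= nc z + nc w.
Proof. exact: (@complex.le_normcD R). Qed.

Lemma ncX z n : nc (z ^+ n) = nc z ^+ n.
Proof. by elim: n => [|n IH]; rewrite ?expr0 ?nc1 // !exprS ncM IH. Qed.

Lemma nc_eq0 z : (nc z == 0) = (z == 0).
Proof.
by apply/eqP/eqP => [|->]; [exact: ComplexField.Normc.eq0_normc|exact: nc0].
Qed.

Lemma nc_gt0 z : (0 < nc z) = (z != 0).
Proof. by rewrite lt0r nc_ge0 andbT nc_eq0. Qed.

Lemma ncMn z n : nc (z *+ n) = nc z *+ n.
Proof. exact: (@complex.normcMn R). Qed.

Lemma nc_distC z w : nc (z - w) = nc (w - z).
Proof. by rewrite -ncN opprB. Qed.

Lemma ncB z w : nc z - nc w <= nc (z - w).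
Proof. by rewrite lerBlDr (le_trans _ (nc_triangle _ _)) // subrK. Qed.

Lemma nc_dist_triangle v z w : nc (z - w) <= nc (z - v) + nc (v - w).
Proof. by rewrite (le_trans _ (nc_triangle _ _)) // addrA subrK. Qed.

Lemma ncR (x : R) : nc (x%:C)%C = `|x|.
Proof.
by rewrite -[LHS]/(Num.sqrt (x ^+ 2 + 0 ^+ 2)) expr0n /= addr0 sqrtr_sqr.
Qed.

Lemma nc_prod (s : seq R[i]) (F : R[i] -> R[i]) :
  nc (\prod_(x <- s) F x) = \prod_(x <- s) nc (F x).
Proof.
elim: s => [|x s IH]; first by rewrite !big_nil nc1.
by rewrite !big_cons ncM IH.
Qed.

Lemma nc_sum (s : seq R[i]) (F : R[i] -> R[i]) :
  nc (\sum_(x <- s) F x) <= \sum_(x <- s) nc (F x).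
Proof.
elim: s => [|x s IH]; first by rewrite !big_nil nc0.
by rewrite !big_cons (le_trans (nc_triangle _ _)) // lerD2l.
Qed.

Lemma nc_sqr (z : R[i]) : nc z ^+ 2 = complex.Re z ^+ 2 + complex.Im z ^+ 2.
Proof. by case: z => a b; rewrite sqr_sqrtr // addr_ge0 ?sqr_ge0. Qed.

Lemma Re_le_nc z : `|complex.Re z| <= nc z.
Proof.
rewrite -(@ler_pXn2r _ 2) ?nnegrE ?nc_ge0 ?normr_ge0 //.
by rewrite real_normK ?num_real // nc_sqr lerDl sqr_ge0.
Qed.

Lemma Im_le_nc z : `|complex.Im z| <= nc z.
Proof.
rewrite -(@ler_pXn2r _ 2) ?nnegrE ?nc_ge0 ?normr_ge0 //.
by rewrite real_normK ?num_real // nc_sqr lerDr sqr_ge0.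
Qed.

Lemma nc_le_ReIm z : nc z <= `|complex.Re z| + `|complex.Im z|.
Proof.
rewrite -(@ler_pXn2r _ 2) ?nnegrE ?nc_ge0 ?addr_ge0 ?normr_ge0 //.
rewrite nc_sqr sqrrD !real_normK ?num_real //.
by rewrite lerD2r lerDl mulrn_wge0 // mulr_ge0.
Qed.

Lemma unit_root (k : nat) (v : R[i]) : (0 < k)%N -> nc v = 1 ->
  exists2 u : R[i], nc u = 1 & u ^+ k = v.
Proof.
move=> k0 v1.
have [u uk] := @solve_monicpoly R[i] k (fun i => if i == 0%N then v else 0) k0.
have {}uk : u ^+ k = v.
  rewrite uk; case: k k0 {uk} => // k _.
  by rewrite big_ord_recl /= big1 ?addr0 ?mulr1 // => i _; rewrite mul0r.
exists u => //; apply/eqP.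
by rewrite -(@pexpr_eq1 _ _ k) ?nc_ge0 // -ncX uk v1.
Qed.

Lemma nc_scale_unit (z u : R[i]) (r : R) : nc u = 1 -> 0 <= r ->
  nc ((r%:C)%C * u) = r.
Proof. by move=> u1 r0; rewrite ncM ncR u1 mulr1 ger0_norm. Qed.

End Modulus.

(** * Local behaviour of polynomials *)

Section Polynomials.
Context {R : realType}.
Implicit Types (z w : R[i]) (p q : {poly R[i]}).

Lemma poly_roots p : p != 0 -> exists2 rs : seq R[i],
  p = lead_coef p *: \prod_(x <- rs) ('X - x%:P) & size rs = (size p).-1.
Proof.
move=> p0; have [rs prs] := closed_field_poly_normal p; exists rs => //.
by rewrite [in RHS]prs size_scale ?lead_coef_eq0 // size_prod_XsubC.
Qed.

Lemma nc_roots p rs : p = lead_coef p *: \prod_(x <- rs) ('X - x%:P) ->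
  forall z, nc p.[z] = nc (lead_coef p) * \prod_(x <- rs) nc (z - x).
Proof.
move=> prs z; rewrite [in LHS]prs hornerZ ncM horner_prod nc_prod.
by congr (_ * _); apply: eq_bigr => x _; rewrite hornerXsubC.
Qed.

Lemma mem_roots p rs : p != 0 -> p = lead_coef p *: \prod_(x <- rs) ('X - x%:P) ->
  forall z, (p.[z] == 0) = (z \in rs).
Proof.
move=> p0 prs z; rewrite -/(root p z) prs rootZ ?lead_coef_eq0 //.
exact: root_prod_XsubC.
Qed.

Lemma poly_bounded p (M : R) : exists2 B : R, 0 < B &
  forall w, nc w <= M -> nc p.[w] <= B.
Proof.
elim/poly_ind: p => [|p c [B B0 IH]].
  by exists 1 => // w _; rewrite horner0 nc0.
exists (B * `|M| + nc c + 1); first by rewrite ltr_wpDl ?addr_ge0 ?mulr_ge0 ?nc_ge0 // ltW.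
move=> w wM; rewrite hornerMXaddC (le_trans (nc_triangle _ _)) // ncM.
rewrite -addrA lerD //; last by rewrite lerDl.
by apply: ler_pM; rewrite ?nc_ge0 ?IH // (le_trans wM) // ler_norm.
Qed.

Lemma divided_difference p z : exists s : {poly R[i]},
  (forall w, p.[w] - p.[z] = (w - z) * s.[w]) /\ s.[z] = p^`().[z].
Proof.
have /factor_theorem[s ps] : root (p - p.[z]%:P) z.
  by rewrite /root hornerD hornerN hornerC subrr.
exists s; split=> [w|].
  have := congr1 (fun q : {poly R[i]} => q.[w]) ps.
  by rewrite hornerD hornerN hornerC hornerM hornerXsubC => ->; rewrite mulrC.
have := congr1 (fun q : {poly R[i]} => q^`().[z]) ps.
rewrite derivB derivC subr0 => ->.
by rewrite derivM derivXsubC mulr1 hornerD hornerM hornerXsubC subrr mulr0 add0r.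
Qed.

Lemma poly_continuous_at p z (e : R) : 0 < e -> exists2 d : R, 0 < d &
  forall w, nc (w - z) < d -> nc (p.[w] - p.[z]) < e.
Proof.
move=> e0; have [s [ps _]] := divided_difference p z.
have [B B0 sB] := poly_bounded s (nc z + 1).
exists (Num.min 1 (e / B)); first by rewrite lt_min ltr01 divr_gt0.
move=> w; rewrite lt_min => /andP[w1 w2]; rewrite ps ncM.
have sw : nc s.[w] <= B.
  by apply: sB; have := ncB w z; lra.
rewrite (@le_lt_trans _ _ (nc (w - z) * B)) ?ler_wpM2l ?nc_ge0 //.
by rewrite -ltr_pdivlMr.
Qed.

Lemma lowest_order_term p z : (1 < size p)%N -> exists k (s : {poly R[i]}),
  [/\ (0 < k)%N, s.[0] != 0 & forall h : R[i], p.[z + h] = p.[z] + h ^+ k * s.[h]].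
Proof.
move=> p1; pose q := (p \Po ('X + z%:P)) - p.[z]%:P.
have q0 : q != 0.
  apply/negP => /eqP/subr0_eq q0.
  have : size (p \Po ('X + z%:P)) = size p by rewrite size_comp_poly2 // size_XaddC.
  by rewrite q0 => E; move: p1; rewrite -E size_polyC; case: (_ != 0).
have [m [s s0 qs]] := multiplicity_XsubC q 0.
rewrite q0 /= in s0.
have E (h : R[i]) : p.[z + h] = p.[z] + h ^+ m * s.[h].
  have := congr1 (fun q : {poly R[i]} => q.[h]) qs.
  rewrite hornerM horner_exp hornerXsubC subr0 /q hornerD hornerN hornerC.
  rewrite horner_comp hornerD hornerX hornerC => /eqP; rewrite subr_eq => /eqP.
  by rewrite [h + z]addrC => ->; rewrite addrC mulrC.
exists m, s; split => //; rewrite lt0n; apply/eqP => m0.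
move: (E 0); rewrite m0 addr0 expr0 mul1r => /eqP.
rewrite -[in X in X == _](addr0 p.[z]) (inj_eq (addrI _)) eq_sym; apply/negP.
exact: s0.
Qed.

(** The direction of the displacement is a [k]-th root that turns the lowest
    order term of [p - p.[z]] into the direction [v]; close to [z] the other
    terms, collected in [c], are smaller than this one. *)
Lemma move_value p z (v : R[i]) (r : R) : (1 < size p)%N -> nc v = 1 -> 0 < r ->
  exists w c (t : R), [/\ nc (w - z) < r, 0 < t, t < r, nc c < t &
    p.[w] = p.[z] + (t%:C)%C * v + c].
Proof.
move=> p1 v1 r0; have [k [s [k0 s0 E]]] := lowest_order_term z p1.
have ns0 : 0 < nc s.[0] by rewrite nc_gt0.
have [u u1 uk] : exists2 u : R[i], nc u = 1 & u ^+ k = v * ((nc s.[0])%:C)%C / s.[0].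
  apply: unit_root => //; rewrite !ncM ncV v1 ncR mul1r ger0_norm ?nc_ge0 //.
  by rewrite divff // gt_eqF.
have [d d0 sd] := poly_continuous_at s 0 ns0.
pose m := Num.min 1 (Num.min r (Num.min d (r / nc s.[0]))).
have m0 : 0 < m by rewrite !lt_min ltr01 r0 d0 divr_gt0.
have [m1 [mr [md ms]]] : m <= 1 /\ m <= r /\ m <= d /\ m <= r / nc s.[0].
  by rewrite /m !ge_min !lexx !orbT.
pose x := m / 2; have x0 : 0 < x by rewrite divr_gt0.
pose h := (x%:C)%C * u; have nh : nc h = x by rewrite nc_scale_unit // ltW.
exists (z + h), (h ^+ k * (s.[h] - s.[0])), (x ^+ k * nc s.[0]).
have xm : x < m by rewrite /x; lra.
have xk0 : 0 < x ^+ k by rewrite exprn_gt0.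
have xk : x ^+ k <= x.
  by rewrite -[leRHS]expr1 ler_wiXn2l //; lra.
split.
- by rewrite addrC addKr nh; lra.
- by rewrite mulr_gt0.
- rewrite -ltr_pdivlMr //; lra.
- rewrite ncM ncX nh ltr_pM2l //; have := sd h; rewrite subr0 nh; apply.
  by rewrite (lt_le_trans xm).
- rewrite E -addrA; congr (_ + _); rewrite /h exprMn uk.
  have -> : (((x ^+ k * nc s.[0])%:C)%C : R[i]) = (x%:C)%C ^+ k * ((nc s.[0])%:C)%C.
    by rewrite rmorphM rmorphXn.
  by field.
Qed.

Lemma poly_larger p z (r : R) : (1 < size p)%N -> 0 < r ->
  exists2 w, nc (w - z) < r & nc p.[z] < nc p.[w].
Proof.
move=> p1 r0.
pose v : R[i] := if p.[z] == 0 then 1 else p.[z] / ((nc p.[z])%:C)%C.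
have v1 : nc v = 1.
  rewrite /v; case: eqP => [_|/eqP pz]; first exact: nc1.
  by rewrite ncM ncV ncR ger0_norm ?nc_ge0 // divff // nc_eq0.
have [w [c [t [wz t0 tr ct pw]]]] := move_value z p1 v1 r0.
exists w => //; rewrite pw.
have -> : p.[z] + (t%:C)%C * v = ((nc p.[z] + t)%:C)%C * v.
  rewrite rmorphD /= mulrDl; congr (_ + _); rewrite /v; case: eqP => [->|/eqP pz].
    by rewrite nc0 mul0r.
  rewrite mulrC divfK //; have := pz; rewrite -nc_eq0 => /eqP H.
  by apply/eqP => -[] /H.
have := ncB (((nc p.[z] + t)%:C)%C * v + c) c.
rewrite addrK nc_scale_unit ?addr_ge0 ?nc_ge0 ?(ltW t0) // => H.
have := nc_triangle (((nc p.[z] + t)%:C)%C * v + c) (- c).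
rewrite addrK ncN nc_scale_unit ?addr_ge0 ?nc_ge0 ?(ltW t0) // => H'.
lra.
Qed.

Lemma poly_smaller p z (r : R) : (1 < size p)%N -> p.[z] != 0 -> 0 < r ->
  exists2 w, nc (w - z) < r & nc p.[w] < nc p.[z].
Proof.
move=> p1 pz r0; have npz : 0 < nc p.[z] by rewrite nc_gt0.
pose v : R[i] := - p.[z] / ((nc p.[z])%:C)%C.
have v1 : nc v = 1 by rewrite ncM ncN ncV ncR ger0_norm ?nc_ge0 // divff // nc_eq0.
have r'0 : 0 < Num.min r (nc p.[z]) by rewrite lt_min r0 npz.
have [w [c [t [wz t0 tr ct pw]]]] := move_value z p1 v1 r'0.
move: wz tr; rewrite !lt_min => /andP[wz _] /andP[_ tr].
exists w => //; rewrite pw.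
have -> : p.[z] + (t%:C)%C * v = ((nc p.[z] - t)%:C)%C * (- v).
  rewrite rmorphB /= mulrBl mulrN mulrN opprK; congr (_ + _).
  rewrite /v mulNr mulrN opprK mulrC divfK //.
  by apply/eqP => -[] /eqP; rewrite gt_eqF.
rewrite (le_lt_trans (nc_triangle _ _)) // nc_scale_unit ?ncN ?subr_ge0 ?(ltW tr) //.
lra.
Qed.

End Polynomials.

(** * Compactness in the plane *)

Section Compactness.
Context {R : realType}.
Implicit Types (z w : R[i]) (phi : R[i] -> R).

(** Stated with the real-valued modulus, because the norm that [R[i]] carries as
    a number field takes its values in [R[i]]. *)
Definition nc_continuous phi := forall z (e : R), 0 < e ->
  exists2 d : R, 0 < d & forall w, nc (w - z) < d -> `|phi w - phi z| < e.

Definition nc_closed (A : set R[i]) := forall z, ~ A z ->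
  exists2 d : R, 0 < d & forall w, nc (w - z) < d -> ~ A w.

Lemma nc_ball_prod (x y a b d : R) : ball ((x, y) : R * R) (d / 2) (a, b) ->
  nc ((a +i* b)%C - (x +i* y)%C) < d.
Proof.
move=> [/=]; rewrite -!ball_normE /= => A B.
apply: le_lt_trans (nc_le_ReIm _) _ => /=.
by rewrite (distrC a) (distrC b); lra.
Qed.

Lemma continuous_pair phi : nc_continuous phi ->
  continuous (fun xy : R * R => phi (xy.1 +i* xy.2)%C).
Proof.
move=> c [x y]; apply/cvgrPdist_lt => e e0.
have [d d0 H] := c (x +i* y)%C e e0.
have d2 : 0 < d / 2 by rewrite divr_gt0.
apply: filterS (nbhsx_ballx (x, y) (d / 2) d2) => -[a b] /nc_ball_prod ab /=.
by rewrite distrC; exact: H.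
Qed.

(** The plane is identified with [R * R], where compact sets are available. *)
Lemma evt_max (A : set R[i]) (M : R) phi : A !=set0 -> (forall z, A z -> nc z <= M) ->
  nc_closed A -> nc_continuous phi ->
  exists2 z, A z & forall w, A w -> phi w <= phi z.
Proof.
move=> [z0 Az0] AM Acl cphi.
pose A' : set (R * R) := [set xy | A (xy.1 +i* xy.2)%C].
have cA : compact A'.
  apply: (@subclosed_compact _ _ (`[- M, M] `*` `[- M, M])).
  - rewrite -[A']setCK; apply: open_closedC; rewrite openE => -[x y] /= nA.
    have [d d0 H] := Acl _ nA; apply/nbhs_ballP; exists (d / 2); first by rewrite /= divr_gt0.
    by move=> [a b] /nc_ball_prod /H.
  - by apply: compact_setX; exact: segment_compact.
  - move=> [x y] /= /AM h; rewrite !in_itv /=.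
    by have := Re_le_nc (x +i* y)%C; have := Im_le_nc (x +i* y)%C => /=;
       rewrite !ler_norml => /andP[? ?] /andP[? ?]; split; lra.
have [||[x y] xA H] := @compact_EVT_max _ R (fun xy : R * R => phi (xy.1 +i* xy.2)%C) A' _ cA.
- by case: z0 Az0 => x y h; exists (x, y).
- by apply: continuous_subspaceT; exact: continuous_pair.
- exists (x +i* y)%C; first by move: xA; rewrite inE.
  by move=> [a b] Aab; apply: (H (a, b)); rewrite inE.
Qed.

Lemma nc_continuousN phi : nc_continuous phi -> nc_continuous (fun z => - phi z).
Proof.
move=> c z e e0; have [d d0 H] := c z e e0; exists d => // w /H.
by rewrite -opprD normrN.
Qed.

Lemma evt_min (A : set R[i]) (M : R) phi : A !=set0 -> (forall z, A z -> nc z <= M) ->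
  nc_closed A -> nc_continuous phi ->
  exists2 z, A z & forall w, A w -> phi z <= phi w.
Proof.
move=> A0 AM Acl cphi.
have [z Az H] := evt_max A0 AM Acl (nc_continuousN cphi).
by exists z => // w /H; rewrite lerN2.
Qed.

Lemma nc_poly_continuous (p : {poly R[i]}) : nc_continuous (fun z => nc p.[z]).
Proof.
move=> z e e0; have [d d0 H] := poly_continuous_at p z e0; exists d => // w /H h.
rewrite (le_lt_trans _ h) // ler_norml.
by have := ncB p.[w] p.[z]; have := ncB p.[z] p.[w]; rewrite nc_distC; lra.
Qed.

Lemma nc_closed_le phi (c : R) : nc_continuous phi -> nc_closed [set z | phi z <= c].
Proof.
move=> cphi z /= /negP; rewrite -ltNge => h.
have [d d0 H] := cphi z (phi z - c) ltac:(by rewrite subr_gt0).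
by exists d => // w /H; rewrite ltr_norml => /andP[? ?]; apply/negP; rewrite -ltNge; lra.
Qed.

Lemma nc_closedI (A B : set R[i]) : nc_closed A -> nc_closed B -> nc_closed (A `&` B).
Proof.
move=> cA cB z nAB; have [Az|nAz] := pselect (A z).
  have [d d0 H] := cB z (fun Bz => nAB (conj Az Bz)).
  by exists d => // w /H nB [].
by have [d d0 H] := cA z nAz; exists d => // w /H nB [].
Qed.

Lemma nc_dist_continuous a : nc_continuous (fun z => nc (z - a)).
Proof.
move=> z e e0; exists e => // w wz.
apply: le_lt_trans wz; rewrite ler_norml.
by have := nc_dist_triangle z w a; have := nc_dist_triangle w z a; rewrite (nc_distC z w); lra.
Qed.

Definition real_continuous (h : R -> R) := forall x (e : R), 0 < e ->
  exists2 d : R, 0 < d & forall y, `|y - x| < d -> `|h y - h x| < e.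

Lemma real_continuousP h : real_continuous h -> continuous h.
Proof.
move=> c x; apply/cvgrPdist_lt => e e0.
have [d d0 H] := c x e e0.
apply: filterS (nbhsx_ballx x d d0) => y; rewrite -ball_normE /= => xy.
by rewrite distrC; apply: H; rewrite distrC.
Qed.

Lemma real_IVT h (a b v : R) : a <= b -> real_continuous h ->
  h a <= v <= h b -> exists2 c, a <= c <= b & h c = v.
Proof.
move=> ab /real_continuousP ch /andP[av vb].
have [|c] := IVT ab (continuous_subspaceT ch) (v := v); last first.
  by rewrite in_itv /=; exists c.
by rewrite ge_min av le_max vb orbT.
Qed.

End Compactness.

(** * Maximum and minimum modulus *)

Section ModulusPrinciple.
Context {R : realType}.
Implicit Types (z w a : R[i]) (p : {poly R[i]}).

Lemma max_modulus p a (r M : R) : 0 <= r ->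
  (forall w, nc (w - a) = r -> nc p.[w] <= M) ->
  forall w, nc (w - a) <= r -> nc p.[w] <= M.
Proof.
move=> r0 HM w0 w0r.
have [p1|p1] := leqP (size p) 1.
  rewrite (size1_polyC p1) hornerC.
  have := HM (a + (r%:C)%C); rewrite addrC addKr ncR ger0_norm // => /(_ erefl).
  by rewrite [in X in X -> _](size1_polyC p1) hornerC.
have [|||z Az zmax] := @evt_max R [set w | nc (w - a) <= r] (nc a + r) _ _ _ _ (nc_poly_continuous p).
- by exists w0.
- by move=> z /= h; have := ncB z a; lra.
- by apply: nc_closed_le; exact: nc_dist_continuous.
apply: le_trans (zmax _ w0r) _; apply: HM; apply/eqP; rewrite eq_le Az /= leNgt.
apply/negP => zr.
have [w wz pw] := poly_larger z p1 (r := r - nc (z - a)) ltac:(by rewrite subr_gt0).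
suff /zmax : nc (w - a) <= r by rewrite leNgt pw.
by have := nc_dist_triangle z w a; lra.
Qed.

Lemma min_modulus_annulus p a (r1 r2 m : R) : 0 <= r1 -> r1 <= r2 ->
  (forall w, r1 <= nc (w - a) -> nc (w - a) <= r2 -> p.[w] != 0) ->
  (forall w, nc (w - a) = r1 -> m <= nc p.[w]) ->
  (forall w, nc (w - a) = r2 -> m <= nc p.[w]) ->
  forall w, r1 <= nc (w - a) -> nc (w - a) <= r2 -> m <= nc p.[w].
Proof.
move=> r10 r12 p0 H1 H2 w0 w01 w02.
have [p1|p1] := leqP (size p) 1.
  rewrite (size1_polyC p1) hornerC.
  have := H1 (a + (r1%:C)%C); rewrite addrC addKr ncR ger0_norm // => /(_ erefl).
  by rewrite [in X in X -> _](size1_polyC p1) hornerC.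
pose A := [set w | nc (w - a) <= r2] `&` [set w | - nc (w - a) <= - r1].
have [|||z [/= Az Az'] zmin] := @evt_min R A (nc a + r2) _ _ _ _ (nc_poly_continuous p).
- by exists w0; split => //=; rewrite lerN2.
- by move=> z [/= h _]; have := ncB z a; lra.
- apply: nc_closedI; apply: nc_closed_le; first exact: nc_dist_continuous.
  by apply: nc_continuousN; exact: nc_dist_continuous.
rewrite lerN2 in Az'.
apply: le_trans (zmin w0 _); last by split => //=; rewrite lerN2.
have [/eqP/H1//|z1] := boolP (nc (z - a) == r1).
have [/eqP/H2//|z2] := boolP (nc (z - a) == r2).
have {}z1 : r1 < nc (z - a) by rewrite lt_neqAle eq_sym z1.
have {}z2 : nc (z - a) < r2 by rewrite lt_neqAle z2.
have d0 : 0 < Num.min (r2 - nc (z - a)) (nc (z - a) - r1) by rewrite lt_min !subr_gt0 z1 z2.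
have [w wz pw] := poly_smaller p1 (p0 z Az' Az) d0.
move: wz; rewrite lt_min => /andP[d1 d2].
suff /zmin : A w by rewrite leNgt pw.
rewrite /A /= lerN2; split; first by have := nc_dist_triangle z w a; lra.
by have := nc_dist_triangle w z a; rewrite (nc_distC z w); lra.
Qed.

End ModulusPrinciple.

(** * Zero-free polynomials that omit a value *)

Section ZeroFree.
Context {R : realType}.
Implicit Types (z w a : R[i]) (p q : {poly R[i]}).

Lemma bernoulli_ge (c : R) n : 0 <= c -> 1 + n%:R * c <= (1 + c) ^+ n.
Proof.
move=> c0; elim: n => [|n IH]; first by rewrite mul0r addr0 expr0.
rewrite exprS -natr1; have n0 : 0 <= n%:R :> R by [].
apply: (@le_trans _ _ ((1 + c) * (1 + n%:R * c))); last by rewrite ler_wpM2l // addr_ge0.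
nra.
Qed.

Lemma expr_unbounded (b x : R) : 1 < b -> exists n, x <= b ^+ n.
Proof.
move=> b1; pose c := b - 1; have c0 : 0 < c by rewrite subr_gt0.
exists (Num.bound (`|x| / c)).
have -> : b = 1 + c by rewrite /c addrC subrK.
apply: le_trans (bernoulli_ge _ (ltW c0)).
have : `|x| / c < (Num.bound (`|x| / c))%:R by rewrite archi_boundP // divr_ge0 // ltW.
rewrite ltr_pdivrMr // => h.
by have := ler_norm x; lra.
Qed.

(** Each factor [w - v] of [p.[w]] loses at most the proportion [x] of its
    modulus between [a] and [w], because [v] is at distance at least [r] from
    [a]. *)
Lemma zero_free_lower p a w (r x : R) : 0 < r -> 0 <= x -> x < 1 ->
  (forall v, nc (v - a) < r -> p.[v] != 0) -> nc (w - a) <= x * r ->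
  nc p.[a] * (1 - x) ^+ (size p).-1 <= nc p.[w].
Proof.
move=> r0 x0 x1 pnz wa.
have p0 : p != 0.
  have := pnz a; rewrite subrr nc0 r0 => /(_ isT).
  by apply: contraNneq => ->; rewrite horner0.
have [rs prs <-] := poly_roots p0.
rewrite !(nc_roots prs) -mulrA ler_wpM2l ?nc_ge0 //.
have : forall v, v \in rs -> r <= nc (v - a).
  move=> v; rewrite -(mem_roots p0 prs) => pv; rewrite leNgt.
  by apply: contraL pv => /pnz.
elim: rs {prs} => [|v rs IH] hrs; first by rewrite !big_nil expr0 mulr1.
rewrite !big_cons /= exprS mulrACA; apply: ler_pM.
- by rewrite mulr_ge0 ?nc_ge0 // subr_ge0 ltW.
- rewrite mulr_ge0 ?exprn_ge0 ?subr_ge0 ?(ltW x1) //.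
  by apply: prodr_ge0 => ? _; exact: nc_ge0.
- have := hrs v (mem_head _ _); rewrite nc_distC => h.
  have := nc_dist_triangle w a v; rewrite (nc_distC a w).
  set A := nc (a - v) in h *; nra.
- by apply: IH => u urs; apply: hrs; rewrite inE urs orbT.
Qed.

(** The left-hand side, divided by [p.[a] ^+ 2], is the second derivative of
    [ln p], which is minus the sum of the [(a - v)^-2] over the roots [v]. *)
Lemma zero_free_logderiv p a (r : R) : 0 < r ->
  (forall v, nc (v - a) < r -> p.[v] != 0) ->
  nc (p^`()^`().[a] * p.[a] - p^`().[a] ^+ 2) <=
  nc p.[a] ^+ 2 * ((size p).-1%:R / r ^+ 2).
Proof.
move=> r0 pnz.
have p0 : p != 0.
  have := pnz a; rewrite subrr nc0 r0 => /(_ isT).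
  by apply: contraNneq => ->; rewrite horner0.
have [rs prs <-] := poly_roots p0.
have {pnz} : forall v, v \in rs -> r <= nc (a - v).
  move=> v; rewrite -(mem_roots p0 prs) => pv; rewrite leNgt.
  by apply: contraL pv; rewrite nc_distC => /pnz.
move: (lead_coef p) prs => c -> hrs; rewrite !derivZ !hornerZ.
set P := \prod_(_ <- _) _.
have -> : c * P^`()^`().[a] * (c * P.[a]) - (c * P^`().[a]) ^+ 2 =
  c ^+ 2 * (P^`()^`().[a] * P.[a] - P^`().[a] ^+ 2) by ring.
rewrite (ncM c) exprMn (ncM (c ^+ 2)) ncX -(mulrA (nc c ^+ 2)) ler_wpM2l ?sqr_ge0 // {}/P.
elim: rs hrs => [|v rs IH] hrs.
  by rewrite !big_nil derivC !deriv0 !horner0 mul0r expr0n /= subr0 nc0 mulr_ge0 ?sqr_ge0 ?divr_ge0 ?sqr_ge0.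
rewrite !big_cons; set Q := \prod_(_ <- _) _ in IH *.
have -> : (('X - v%:P) * Q)^`()^`().[a] * (('X - v%:P) * Q).[a] - (('X - v%:P) * Q)^`().[a] ^+ 2
  = (a - v) ^+ 2 * (Q^`()^`().[a] * Q.[a] - Q^`().[a] ^+ 2) - Q.[a] ^+ 2.
  have E : (('X - v%:P) * Q)^`() = Q + ('X - v%:P) * Q^`().
    by rewrite derivM derivXsubC mul1r.
  rewrite E derivD derivM derivXsubC mul1r.
  by rewrite !(hornerXsubC, hornerM, hornerD); ring.
rewrite (le_trans (nc_triangle _ _)) // ncN ncM !ncX hornerM hornerXsubC ncM exprMn.
have h1 := hrs v (mem_head _ _).
have {}IH := IH (fun u urs => hrs u (mem_behead (s := v :: rs) urs)).
set A := nc (_ - _ ^+ 2) in IH *; set U := nc (a - v) in h1 *; set q := nc Q.[a] in IH *.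
have U2 : r ^+ 2 <= U ^+ 2 by rewrite lerXn2r // nnegrE ?nc_ge0 // ltW.
have r2 : 0 < r ^+ 2 by rewrite exprn_gt0.
have -> : U ^+ 2 * q ^+ 2 * ((size (v :: rs))%:R / r ^+ 2) =
  U ^+ 2 * (q ^+ 2 * ((size rs)%:R / r ^+ 2)) + q ^+ 2 * (U ^+ 2 / r ^+ 2).
  by rewrite /= -natr1; field; rewrite gt_eqF.
apply: lerD; first by rewrite ler_wpM2l // sqr_ge0.
by rewrite ler_peMr ?sqr_ge0 // ler_pdivlMr // mul1r.
Qed.

(** [p] and [p - k] have the same derivatives, so that the two instances of
    [zero_free_logderiv] can be combined to eliminate the second one; what
    remains is [p' ^+ 2 * k]. *)
Lemma two_value_deriv p a (k : R[i]) (r : R) : 0 < r ->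
  (forall v, nc (v - a) < r -> p.[v] != 0) ->
  (forall v, nc (v - a) < r -> p.[v] - k != 0) -> (1 < size p)%N ->
  nc p^`().[a] ^+ 2 * nc k <= nc p.[a] * nc (p.[a] - k) *
    (nc p.[a] + nc (p.[a] - k)) * ((size p).-1%:R / r ^+ 2).
Proof.
move=> r0 h1 h2 p1; pose q := p - k%:P.
have q2 : forall v, nc (v - a) < r -> q.[v] != 0.
  by move=> v /h2; rewrite /q hornerD hornerN hornerC.
have sq : size q = size p.
  by rewrite /q size_addl // size_polyN (leq_ltn_trans (size_polyC_leq1 _)).
have A := zero_free_logderiv r0 h1; have B := zero_free_logderiv r0 q2.
move: B; rewrite sq {2}/q [in X in X - _]/q /q derivB derivC subr0 hornerD hornerN hornerC => B.
set P := p.[a] in A B *; set P' := p^`().[a] in A B *; set P'' := p^`()^`().[a] in A B *.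
set D := _ / _ in A B *.
have E : P' ^+ 2 * k = (P - k) * (P'' * P - P' ^+ 2) + P * (- (P'' * (P - k) - P' ^+ 2)) by ring.
rewrite -ncX -ncM E (le_trans (nc_triangle _ _)) // !ncM ncN.
have := nc_ge0 P; have := nc_ge0 (P - k).
move: A B; set x := nc P; set y := nc (P - k); set u := nc (_ - _); set v := nc (_ - _).
move=> A B y0 x0.
have := ler_wpM2l x0 B; have := ler_wpM2l y0 A; lra.
Qed.

(** Towards [a] the function [nc p] increases from [L] at least like
    [L * (1 - s) ^- k], whose derivative at [s = 0] is [k * L]. *)
Lemma deriv_lower p a z (L : R) k : nc p.[z] <= L -> 0 < L -> z != a ->
  (exists2 s0 : R, 0 < s0 & forall s, 0 < s -> s < s0 ->
     L <= nc p.[z - (s%:C)%C * (z - a)] * (1 - s) ^+ k) ->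
  k%:R * L <= nc p^`().[z] * nc (z - a).
Proof.
move=> pL L0 za [s0 s00 H]; rewrite leNgt; apply/negP => lt.
have [t [pt tz]] := divided_difference p z.
set rho := nc (z - a) in lt; have rho0 : 0 < rho by rewrite nc_gt0 subr_eq0.
pose e := (k%:R * L / rho - nc p^`().[z]).
have e0 : 0 < e by rewrite subr_gt0 ltr_pdivlMr.
have [d d0 td] := poly_continuous_at t z e0.
pose m := Num.min 1 (Num.min s0 (d / rho)).
have m0 : 0 < m by rewrite !lt_min ltr01 s00 divr_gt0.
have [m1 [ms md]] : m <= 1 /\ m <= s0 /\ m <= d / rho.
  by rewrite /m !ge_min !lexx !orbT.
pose s := m / 2; have sm : s < m by rewrite /s; lra.
have sp : 0 < s by rewrite divr_gt0.
have := H s sp (lt_le_trans sm ms).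
set w := z - _ * _.
have wz : nc (w - z) = s * rho by rewrite /w addrC addKr ncN ncM ncR gtr0_norm.
have tw : nc t.[w] < k%:R * L / rho.
  have := td w; rewrite wz -ltr_pdivlMr // (lt_le_trans sm md) => /(_ isT).
  by have := ncB t.[w] t.[z]; rewrite tz /e; lra.
have pw : nc p.[w] <= L + s * (k%:R * L).
  have -> : p.[w] = p.[z] + (w - z) * t.[w] by rewrite -pt addrC subrK.
  rewrite (le_trans (nc_triangle _ _)) // lerD // ncM wz -mulrA ler_pM2l //.
  by rewrite mulrC -ler_pdivlMr // ltW.
have k0 : (0 < k)%N.
  rewrite lt0n; apply/eqP => kk; move: e0; rewrite /e kk !mul0r sub0r oppr_gt0.
  by rewrite ltNge nc_ge0.
have pw' : nc p.[w] < L + s * (k%:R * L).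
  have -> : p.[w] = p.[z] + (w - z) * t.[w] by rewrite -pt addrC subrK.
  rewrite (le_lt_trans (nc_triangle _ _)) // ler_ltD // ncM wz -mulrA ltr_pM2l //.
  by rewrite mulrC -ltr_pdivlMr.
have s1 : 0 < 1 - s by lra.
(* Bernoulli's inequality in the form [(1 - s) ^- n >= 1 + n * s]. *)
have bern : forall n, (1 + n%:R * s) * (1 - s) ^+ n <= 1.
  elim=> [|n IH]; first by rewrite mul0r addr0 expr0 mulr1.
  apply: le_trans IH; rewrite exprS mulrA ler_pM2r ?exprn_gt0 //.
  rewrite -natr1; have n0 : 0 <= n%:R :> R by []. nra.
rewrite leNgt => /negP; apply.
apply: (@lt_le_trans _ _ ((L + s * (k%:R * L)) * (1 - s) ^+ k)).
  by rewrite ltr_pM2r // exprn_gt0.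
have -> : (L + s * (k%:R * L)) * (1 - s) ^+ k = L * ((1 + k%:R * s) * (1 - s) ^+ k) by ring.
by rewrite ler_piMr // ltW.
Qed.


(** Among the points where [|p| <= L], the one closest to [z1] has a steep
    slope. This is Hopf's boundary lemma for [ln |p|]: on the disc around [z1]
    through that point [ln |p|] is at least [ln L], on a small concentric disc
    it is larger by a multiple of the degree, and in between the zero-free
    polynomial [(X - z1)^m * p] obeys the minimum modulus principle. *)
Lemma steep_point (r B : R) : 0 < r -> 1 < B -> exists2 j : nat, (0 < j)%N &
  forall p (z0 z1 : R[i]) (L : R), (1 < size p)%N -> 0 < L ->
  (forall v, nc (v - z1) < r -> p.[v] != 0) -> nc (z0 - z1) <= r / 2 ->
  nc p.[z0] <= L -> L * B ^+ (size p).-1 <= nc p.[z1] ->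
  exists z, [/\ nc (z - z1) <= r / 2, nc p.[z] <= L &
    ((size p).-1 %/ j)%:R * L <= nc p^`().[z] * (r / 2)].
Proof.
move=> r0 B1.
(* One factor [b ^+ D] of [B ^+ D = b ^+ D * b ^+ D] is lost between [z1] and
   the circle of radius [x * r]; the other one pays for [(x^-1) ^+ m]. *)
pose b := Num.sqrt B; have b1 : 1 < b by rewrite -sqrtr1 ltr_sqrt // (lt_trans ltr01).
have bB : b ^+ 2 = B by rewrite sqr_sqrtr // ltW // (lt_trans ltr01).
have b0 : 0 < b by rewrite (lt_trans ltr01).
pose x := 1 - b^-1.
have x0 : 0 < x by rewrite subr_gt0 invf_lt1.
have x1 : x < 1 by rewrite gtrBl invr_gt0.
have [j jx] := expr_unbounded x^-1 b1.
have j0 : (0 < j)%N.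
  by rewrite lt0n; apply/eqP => j0; move: jx; rewrite j0 expr0 invf_le1 // leNgt x1.
exists j => // p z0 z1 L p1 L0 h1 z01 pz0 pz1.
set D := (size p).-1 in pz1 *.
have D0 : (0 < D)%N by rewrite /D -subn1 subn_gt0.
have inner w : nc (w - z1) <= x * r -> L * b ^+ D <= nc p.[w].
  move=> /(zero_free_lower r0 (ltW x0) x1 h1); apply: le_trans.
  have -> : 1 - x = b^-1 by rewrite /x opprB addrCA subrr addr0.
  apply: (@le_trans _ _ (L * B ^+ D * b^-1 ^+ D)); last by rewrite ler_wpM2r // exprn_ge0 // invr_ge0 ltW.
  by rewrite -bB -exprM mulnC exprM expr2 exprVn mulrA mulfK // expf_neq0 // gt_eqF.
have bD : 1 < b ^+ D by rewrite exprn_egt1 // -lt0n.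
pose A := [set w : R[i] | nc p.[w] <= L] `&` [set w | nc (w - z1) <= r / 2].
have [|||z [/= zL zr] zmin] := @evt_min R A (nc z1 + r / 2) _ _ _ _ (@nc_dist_continuous R z1).
- by exists z0; split.
- by move=> w [_ /= h]; have := ncB w z1; lra.
- apply: nc_closedI; apply: nc_closed_le; first exact: nc_poly_continuous.
  exact: nc_dist_continuous.
set rho := nc (z - z1) in zr zmin.
have rho1 : x * r < rho.
  rewrite ltNge; apply/negP => /inner; rewrite leNgt => /negP; apply.
  by rewrite (le_lt_trans zL) // ltr_pMr.
have rho0 : 0 < rho by rewrite (le_lt_trans _ rho1) // mulr_ge0 // ltW.
have outside w : nc (w - z1) < rho -> L < nc p.[w].
  move=> wr; rewrite ltNge; apply/negP => pw.
  by have := zmin w; rewrite leNgt wr => H; have : false by apply: H; split => //=; lra.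
(* On the circle itself the bound follows by continuity from inside. *)
have outer w : nc (w - z1) <= rho -> L <= nc p.[w].
  rewrite le_eqVlt => /orP[/eqP wr|/outside/ltW//]; rewrite leNgt; apply/negP => pw.
  have [d d0 pd] := @nc_poly_continuous R p w (L - nc p.[w]) ltac:(by rewrite subr_gt0).
  pose s := Num.min (1 / 2) (d / rho / 2).
  have s0 : 0 < s by rewrite lt_min !divr_gt0.
  have s1 : s <= 1 / 2 by rewrite /s ge_min lexx.
  have sd : s * rho < d.
    have : s <= d / rho / 2 by rewrite /s ge_min lexx orbT.
    have : 0 < d / rho by rewrite divr_gt0.
    by rewrite -ltr_pdivlMr //; lra.
  have := pd (w - (s%:C)%C * (w - z1)).
  rewrite addrAC subrr add0r ncN ncM ncR wr gtr0_norm // sd => /(_ isT).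
  have := outside (w - (s%:C)%C * (w - z1)).
  have -> : w - (s%:C)%C * (w - z1) - z1 = ((1 - s)%:C)%C * (w - z1).
    by rewrite rmorphB /= mulrBl mul1r; ring.
  rewrite ncM ncR wr gtr0_norm ?subr_gt0; last by lra.
  rewrite gtr_pMl // gtrBl s0 => /(_ isT) h; rewrite ltr_norml => /andP[_]; lra.
pose m := (D %/ j)%N.
have mD : (m * j <= D)%N by exact: leq_trunc_div.
have za : z != z1 by rewrite -subr_eq0 -nc_gt0.
have bar w : x * r <= nc (w - z1) -> nc (w - z1) <= rho ->
    rho ^+ m * L <= nc (('X - z1%:P) ^+ m * p).[w].
  apply: min_modulus_annulus; first by rewrite mulr_ge0 // ltW.
  - exact: ltW.
  - move=> v v1 v2; rewrite hornerM horner_exp hornerXsubC mulf_neq0 //; last by apply: h1; lra.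
    by rewrite expf_neq0 // -nc_gt0 (lt_le_trans _ v1) // mulr_gt0.
  - move=> v v1; rewrite hornerM horner_exp hornerXsubC ncM ncX v1.
    have /inner h : nc (v - z1) <= x * r by rewrite v1.
    apply: le_trans (ler_wpM2l _ h); last by rewrite exprn_ge0 // mulr_ge0 // ltW.
    rewrite mulrCA mulrC ler_pM2l //.
    apply: (@le_trans _ _ (r ^+ m)); first by rewrite lerXn2r // ?nnegrE; lra.
    rewrite exprMn mulrAC ler_peMl ?exprn_ge0 ?(ltW r0) //.
    apply: (@le_trans _ _ (x ^+ m * b ^+ (m * j))); last first.
      by rewrite ler_wpM2l ?exprn_ge0 ?(ltW x0) // ler_eXn2l.
    rewrite mulnC exprM -exprMn exprn_ege1 //.
    by rewrite mulrC -ler_pdivrMr // div1r.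
  - move=> v v1; rewrite hornerM horner_exp hornerXsubC ncM ncX v1 ler_wpM2l ?exprn_ge0 ?(ltW rho0) //.
    by apply: outer; rewrite v1.
have hopf : m%:R * L <= nc p^`().[z] * rho.
  apply: deriv_lower => //; exists (Num.min 1 (1 - x * r / rho)).
    by rewrite lt_min ltr01 subr_gt0 ltr_pdivrMr // mul1r.
  move=> s s0; rewrite lt_min => /andP[s1 s2].
  set w := z - _ * _.
  have wz : w - z1 = ((1 - s)%:C)%C * (z - z1).
    by rewrite /w rmorphB /= mulrBl mul1r; ring.
  have nw : nc (w - z1) = (1 - s) * rho by rewrite wz ncM ncR gtr0_norm // subr_gt0.
  have := bar w; rewrite nw.
  rewrite hornerM horner_exp hornerXsubC ncM ncX nw exprMn.
  have -> : (1 - s) ^+ m * rho ^+ m * nc p.[w] = rho ^+ m * (nc p.[w] * (1 - s) ^+ m) by ring.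
  rewrite ler_pM2l ?exprn_gt0 // => H; apply: H.
    rewrite -ler_pdivrMr //; lra.
  by rewrite ger_pMl //; lra.
exists z; split => //; apply: le_trans hopf _.
by rewrite ler_wpM2l ?nc_ge0.
Qed.

(** The quantitative form of Montel's theorem for polynomials. If [p] omitted
    both [0] and [k], then [two_value_deriv] would bound the slope of [ln |p|]
    by the square root of the degree, while [steep_point] makes it
    proportional to the degree. *)
Lemma two_values (r B M : R) : 0 < r -> 1 < B -> exists D0 : nat,
  forall p (k z0 z1 : R[i]) (L : R), (D0 <= (size p).-1)%N ->
  k != 0 -> nc k <= L -> L <= M * nc k -> nc (z0 - z1) <= r / 2 ->
  nc p.[z0] <= L -> L * B ^+ (size p).-1 <= nc p.[z1] ->
  exists2 w, nc (w - z1) < r & p.[w] = 0 \/ p.[w] = k.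
Proof.
move=> r0 B1; have [j j0 steep] := steep_point r0 B1.
(* The two estimates of the slope give [m ^+ 2 <= 6 * M * D] for [m = D %/ j],
   hence [m <= 12 * M * j]. *)
pose K := Num.bound (12 * `|M| * j%:R).
exists (j * K.+1)%N => p k z0 z1 L pD k0 kL LM z01 pz0 pz1.
have nk0 : 0 < nc k by rewrite nc_gt0.
have L0 : 0 < L by exact: lt_le_trans kL.
have p1 : (1 < size p)%N.
  by rewrite -subn_gt0 subn1 (leq_trans _ pD) // muln_gt0 j0.
apply: contrapT => nroot.
have h1 v : nc (v - z1) < r -> p.[v] != 0.
  by move=> vr; apply/eqP => pv; apply: nroot; exists v => //; left.
have h2 v : nc (v - z1) < r -> p.[v] - k != 0.
  by move=> vr; rewrite subr_eq0; apply/eqP => pv; apply: nroot; exists v => //; right.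
have [z [zr zL hopf]] := steep p z0 z1 L p1 L0 h1 z01 pz0 pz1.
set D := (size p).-1 in pD hopf *.
pose m := (D %/ j)%N; rewrite -/m in hopf.
have mK : (K < m)%N by rewrite leq_divRL // mulnC.
have g1 v : nc (v - z) < r / 2 -> p.[v] != 0.
  by move=> vz; apply: h1; have := nc_dist_triangle z v z1; lra.
have g2 v : nc (v - z) < r / 2 -> p.[v] - k != 0.
  by move=> vz; apply: h2; have := nc_dist_triangle z v z1; lra.
have r20 : 0 < r / 2 by rewrite divr_gt0.
have := two_value_deriv r20 g1 g2 p1; rewrite -/D.
set P' := nc _ in hopf *; set P := nc p.[z] in zL *; set Q := nc (p.[z] - k).
have Q2 : Q <= 2 * L by have := nc_triangle p.[z] (- k); rewrite ncN -/Q -/P; lra.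
have P0 : 0 <= P by exact: nc_ge0.
have Q0 : 0 <= Q by exact: nc_ge0.
have P'0 : 0 <= P' by exact: nc_ge0.
move=> H.
have {}H : P' ^+ 2 * nc k <= L * (2 * L) * (3 * L) * (D%:R / (r / 2) ^+ 2).
  apply: le_trans H _; rewrite ler_wpM2r ?divr_ge0 ?sqr_ge0 //.
  apply: ler_pM; rewrite ?mulr_ge0 ?addr_ge0 //; last by lra.
  by apply: ler_pM.
have h' : (m%:R * L) ^+ 2 <= (P' * (r / 2)) ^+ 2.
  by rewrite lerXn2r // nnegrE mulr_ge0 // ltW.
have h'' : (m%:R * L) ^+ 2 * nc k <= 6 * L ^+ 3 * D%:R.
  apply: (@le_trans _ _ ((P' * (r / 2)) ^+ 2 * nc k)); first by rewrite ler_wpM2r // ltW.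
  rewrite exprMn mulrAC.
  apply: le_trans (ler_wpM2r (sqr_ge0 _) H) _.
  by rewrite le_eqVlt; apply/orP; left; apply/eqP; field; rewrite gt_eqF.
have M0 : 0 < M by have : 0 < M * nc k by [exact: lt_le_trans LM]; rewrite pmulr_lgt0.
have mD' : m%:R ^+ 2 <= 6 * M * D%:R.
  rewrite -(ler_pM2r (exprn_gt0 3 L0)).
  apply: (@le_trans _ _ ((m%:R * L) ^+ 2 * nc k * M)); last first.
    by apply: le_trans (ler_wpM2r (ltW M0) h'') _; rewrite le_eqVlt; apply/orP; left; apply/eqP; ring.
  have -> : m%:R ^+ 2 * L ^+ 3 = (m%:R * L) ^+ 2 * L by ring.
  by rewrite -mulrA ler_wpM2l ?sqr_ge0 // mulrC.
have Dm : D%:R <= 2 * m%:R * j%:R :> R.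
  rewrite -!natrM ler_nat.
  have := ltn_ceil D j0; rewrite -/m => /ltnW/leq_trans; apply.
  by rewrite leq_mul2r mul2n -addnn -addn1 leq_add2l (leq_ltn_trans _ mK) ?orbT.
have m0 : 0 < m%:R :> R by rewrite ltr0n (leq_ltn_trans _ mK).
have : m%:R <= 12 * M * j%:R.
  rewrite -(ler_pM2r m0) -expr2 (le_trans mD') //.
  apply: le_trans (ler_wpM2l _ Dm) _; first by rewrite mulr_ge0 // ltW.
  by rewrite le_eqVlt; apply/orP; left; apply/eqP; ring.
apply/negP; rewrite -ltNge.
have : 12 * `|M| * j%:R < K%:R by rewrite archi_boundP // !mulr_ge0.
rewrite gtr0_norm // => /lt_trans; apply.
by rewrite ltr_nat.
Qed.

End ZeroFree.

(** * Iterates of a polynomial *)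

Section Iterates.
Context {R : realType}.
Implicit Types (f p : {poly R[i]}) (z w : R[i]).

Definition orb f n z : R[i] := iter n (horner f) z.

Definition deg f : nat := (size f).-1.

Definition iter_poly f n : {poly R[i]} := iter n (fun p => f \Po p) 'X.

Lemma horner_iter_poly f n z : (iter_poly f n).[z] = orb f n z.
Proof.
by elim: n => [|n IH]; rewrite /= ?hornerX // horner_comp IH.
Qed.

Lemma size_iter_poly f n : (1 < size f)%N -> (size (iter_poly f n)).-1 = (deg f ^ n)%N.
Proof.
move=> f1; elim: n => [|n IH]; first by rewrite /= size_polyX expn0.
by rewrite /iter_poly /= size_comp_poly IH expnS.
Qed.

Lemma orbS f n z : orb f n.+1 z = f.[orb f n z].
Proof. by []. Qed.

Lemma orbSr f n z : orb f n.+1 z = orb f n f.[z].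
Proof. by rewrite /orb iterSr. Qed.

Lemma poly_surj p w : (1 < size p)%N -> exists z, p.[z] = w.
Proof.
move=> p1; have [|z] := closed_rootP (p - w%:P) _.
  rewrite size_addl ?size_polyN ?(leq_ltn_trans (size_polyC_leq1 _)) //.
  by rewrite neq_ltn p1 orbT.
by rewrite /root hornerD hornerN hornerC subr_eq0 => /eqP; exists z.
Qed.

Lemma poly_upper p : exists2 M : R, 1 <= M & forall z,
  1 + nc p.[z] <= M * (1 + nc z) ^+ deg p.
Proof.
have [->|p0] := eqVneq p 0.
  by exists 1 => // z; rewrite horner0 nc0 addr0 mul1r /deg size_poly0 expr0.
have [rs prs srs] := poly_roots p0.
have P0 : 0 <= \prod_(x <- rs) (1 + nc x).
  by apply: prodr_ge0 => x _; rewrite addr_ge0 ?nc_ge0.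
exists (1 + nc (lead_coef p) * \prod_(x <- rs) (1 + nc x)).
  by rewrite lerDl mulr_ge0 ?nc_ge0.
move=> z; rewrite mulrDl mul1r; apply: lerD.
  by rewrite exprn_ege1 // lerDl nc_ge0.
rewrite (nc_roots prs) -mulrA ler_wpM2l ?nc_ge0 // /deg -srs.
elim: rs {prs srs P0} => [|x rs IH]; first by rewrite !big_nil expr0 mulr1.
rewrite !big_cons /= exprS mulrACA; apply: ler_pM => //.
- exact: nc_ge0.
- by apply: prodr_ge0 => ? _; exact: nc_ge0.
- have := nc_ge0 x; have := nc_ge0 z; have := nc_triangle z (- x); rewrite ncN.
  set a := nc _; set b := nc z; set c := nc x; nra.
Qed.

(** Far from the roots every factor is bounded below by a multiple of
    [1 + nc z]; on the remaining disc the left-hand side is bounded. *)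
Lemma poly_lower p : p != 0 -> exists2 M : R, 1 <= M & forall z,
  (1 + nc z) ^+ deg p <= M * (1 + nc p.[z]).
Proof.
move=> p0; have [rs prs srs] := poly_roots p0.
have lp : 0 < nc (lead_coef p) by rewrite nc_gt0 lead_coef_eq0.
pose R0 : R := 1 + \sum_(x <- rs) nc x.
have S0 (s : seq R[i]) : 0 <= \sum_(x <- s) nc x by apply: sumr_ge0 => x _; exact: nc_ge0.
have P0 (s : seq R[i]) : 0 <= \prod_(x <- s) (2 + nc x).
  by apply: prodr_ge0 => x _; rewrite addr_ge0 ?nc_ge0.
have A1 : 1 <= (1 + R0) ^+ deg p by rewrite exprn_ege1 // lerDl addr_ge0.
have B0 : 0 <= (\prod_(x <- rs) (2 + nc x)) / nc (lead_coef p) by rewrite divr_ge0 // ltW.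
exists ((1 + R0) ^+ deg p + (\prod_(x <- rs) (2 + nc x)) / nc (lead_coef p)).
  by rewrite (le_trans A1) // lerDl.
move=> z; have [zR|zR] := leP (nc z) R0.
  apply: (@le_trans _ _ ((1 + R0) ^+ deg p)).
    by rewrite lerXn2r ?nnegrE ?addr_ge0 ?nc_ge0 // lerD2l.
  have := nc_ge0 p.[z]; move: A1 B0; set a := _ ^+ _; set b := _ / _; set c := nc _; nra.
apply: (@le_trans _ _ ((\prod_(x <- rs) (2 + nc x)) / nc (lead_coef p) * nc p.[z])); last first.
  have := nc_ge0 p.[z]; move: A1 B0; set a := _ ^+ _; set b := _ / _; set c := nc _; nra.
rewrite (nc_roots prs) mulrA divfK ?gt_eqF // -big_split /= /deg -srs.
have : forall x, x \in rs -> 1 + nc x <= nc z.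
  move=> x xrs; apply: le_trans (ltW zR); rewrite lerD2l (big_rem x) //= lerDl; exact: S0.
elim: rs {prs srs zR A1 B0 R0} => [|x rs IH] hrs; first by rewrite big_nil expr0.
rewrite big_cons /= exprS; apply: ler_pM; last 1 first.
- by apply: IH => y yrs; apply: hrs; rewrite inE yrs orbT.
- by rewrite addr_ge0 ?nc_ge0.
- by rewrite exprn_ge0 // addr_ge0 ?nc_ge0.
- have := hrs x (mem_head _ _); have := nc_ge0 x; have := nc_dist_triangle x z 0; rewrite !subr0.
  set a := nc (z - x); set b := nc z; set c := nc x; nra.
Qed.

End Iterates.

(** * The Green function *)

Section Green.
Context {R : realType}.
Variable f : {poly R[i]}.
Hypothesis f2 : (2 <= deg f)%N.
Implicit Types z w : R[i].

Local Notation d := ((deg f)%:R : R).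

Let d2 : 2 <= d. Proof. by rewrite ler_nat. Qed.
Let d0 : 0 < d. Proof. by have := d2; lra. Qed.
Let dX n : 0 < d ^+ n. Proof. by rewrite exprn_gt0. Qed.

Lemma deg_size : (1 < size f)%N.
Proof. by move: f2; rewrite /deg; case: size => [|[|]]. Qed.

Lemma deg_neq0 : f != 0.
Proof. by rewrite -size_poly_gt0 (ltn_trans _ deg_size). Qed.

Definition lsize z : R := ln (1 + nc z).

Lemma lsize_ge0 z : 0 <= lsize z.
Proof. by rewrite ln_ge0 // lerDl nc_ge0. Qed.

Lemma lsize_growth : exists2 C : R, 0 <= C &
  forall z, `|lsize f.[z] - d * lsize z| <= C.
Proof.
have [M M1 HM] := poly_upper f; have [N N1 HN] := poly_lower deg_neq0.
have pos z : 0 < 1 + nc z by rewrite ltr_pwDl ?nc_ge0.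
exists (ln M + ln N); first by rewrite addr_ge0 ?ln_ge0.
move=> z; have lM := ln_ge0 M1; have lN := ln_ge0 N1.
have E : d * lsize z = ln ((1 + nc z) ^+ deg f) by rewrite lnXn // mulr_natl.
have M0 : 0 < M by lra. have N0 : 0 < N by lra.
have h1 : lsize f.[z] <= ln M + d * lsize z.
  by rewrite E -lnM ?posrE ?exprn_gt0 // ler_ln ?posrE ?mulr_gt0 ?exprn_gt0.
have h2 : d * lsize z <= ln N + lsize f.[z].
  by rewrite E -lnM ?posrE ?exprn_gt0 // ler_ln ?posrE ?mulr_gt0 ?exprn_gt0.
rewrite ler_norml; lra.
Qed.

(** The escape rate. [ln (1 + nc z)] differs by a bounded quantity from the
    positive part of [ln (nc z)], so this is the Green function of the basin of
    infinity with pole at infinity, extended by [0] to the filled Julia set. *)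
Definition green z : R := limn (fun n => lsize (orb f n z) / d ^+ n).

Lemma bounded_expr_le0 (x C : R) : (forall n, x * d ^+ n <= C) -> x <= 0.
Proof.
move=> H; rewrite leNgt; apply/negP => x0.
have [n] := expr_unbounded ((C + 1) / x) (b := d) ltac:(by have := d2; lra).
by rewrite ler_pdivrMr // mulrC; have := H n; lra.
Qed.

Lemma green_bound : exists2 C : R, 0 <= C & forall n z,
  `|d ^+ n * green z - lsize (orb f n z)| <= C.
Proof.
have [C C0 HC] := lsize_growth; exists C => // n z.
(* [a] increases and [b] decreases because [d >= 2], so that both bound the
   limit. *)
pose l m := lsize (orb f m z).
pose a m := (l m - C) / d ^+ m; pose b m := (l m + C) / d ^+ m.
have ab m : a m <= b m by rewrite ler_pM2r ?invr_gt0 // lerD2l; have := C0; lra.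
have aS m : a m <= a m.+1.
  rewrite /a ler_pdivrMr // mulrAC ler_pdivlMr // exprS mulrA ler_pM2r //.
  by have := HC (orb f m z); have := d2; rewrite -orbS -/(l m) -/(l m.+1) ler_norml => ? /andP[? ?]; nra.
have bS m : b m.+1 <= b m.
  rewrite /b ler_pdivrMr // mulrAC ler_pdivlMr // exprS mulrA ler_pM2r //.
  by have := HC (orb f m z); have := d2; rewrite -orbS -/(l m) -/(l m.+1) ler_norml => ? /andP[? ?]; nra.
have na : {homo a : n m / (n <= m)%N >-> n <= m} by apply/nondecreasing_seqP.
have nb : {homo b : n m / (n <= m)%N >-> m <= n} by apply/nonincreasing_seqP.
have abm i j : a i <= b j.
  have [ij|ij] := leqP i j; first by rewrite (le_trans (na _ _ ij)).
  by rewrite (le_trans (ab _)) // nb // ltnW.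
have ca := nondecreasing_cvgn na (ex_intro _ (b 0%N) _ : has_ubound (range a)).
have {}ca : a x @[x --> \oo] --> sup (range a).
  by apply: ca => _ [i _ <-]; exact: abm.
have lim0 : (fun m => C / d ^+ m) @ \oo --> 0.
  rewrite -(mulr0 C); apply: cvgMr.
  have -> : (fun m => (d ^+ m)^-1) = (fun m => d^-1 ^+ m).
    by apply/funext => m; rewrite exprVn.
  by apply: cvg_expr; rewrite gtr0_norm ?invr_gt0 // invf_lt1 //; have := d2; lra.
have -> : green z = sup (range a).
  apply: cvg_lim => //; rewrite -[sup _]addr0.
  have -> : (fun n => lsize (orb f n z) / d ^+ n) = (fun n => a n + C / d ^+ n).
    by apply/funext => m; rewrite /a -mulrDl subrK.
  exact: cvgD.
have aG : a n <= sup (range a).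
  by apply: ub_le_sup; [exists (b 0%N) => _ [i _ <-]; exact: abm|exists n].
have Gb : sup (range a) <= b n.
  by apply: ge_sup; [exists (a n); exists n|move=> _ [i _ <-]; exact: abm].
move: aG Gb; rewrite /a /b ler_pdivrMr // ler_pdivlMr // -/(l n) ler_norml mulrC; lra.
Qed.

Lemma green_ge0 z : 0 <= green z.
Proof.
have [C C0 HC] := green_bound; rewrite -oppr_le0; apply: (@bounded_expr_le0 _ C) => n.
by have := HC n z; have := lsize_ge0 (orb f n z); rewrite ler_norml mulNr mulrC => ? /andP[? ?]; lra.
Qed.

Lemma green_poly z : green f.[z] = d * green z.
Proof.
have [C C0 HC] := green_bound.
suff H (x : R) : (forall n, `|x| * d ^+ n <= C + C) -> x = 0.
  apply/eqP; rewrite -subr_eq0; apply/eqP/H => n.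
  have := HC n f.[z]; have := HC n.+1 z; rewrite orbSr exprS => h1 h2.
  rewrite -[d ^+ n]gtr0_norm // -normrM mulrBl.
  have -> : green f.[z] * d ^+ n - d * green z * d ^+ n =
    (d ^+ n * green f.[z] - lsize (orb f n f.[z])) - (d * d ^+ n * green z - lsize (orb f n f.[z])) by ring.
  by rewrite (le_trans (ler_normB _ _)) // lerD.
by move/bounded_expr_le0; rewrite normr_le0 => /eqP.
Qed.

Lemma green_orb n z : green (orb f n z) = d ^+ n * green z.
Proof.
by elim: n => [|n IH]; rewrite ?expr0 ?mul1r // orbS green_poly IH exprS mulrA.
Qed.

Lemma orb_bounds : exists2 A : R, 1 <= A & forall n z,
  1 + nc (orb f n z) <= A * expR (d ^+ n * green z) /\
  expR (d ^+ n * green z) <= A * (1 + nc (orb f n z)).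
Proof.
have [C C0 HC] := green_bound; exists (expR C); first by rewrite -expR0 ler_expR.
have pos z : 0 < 1 + nc z by rewrite ltr_pwDl ?nc_ge0.
move=> n z; have := HC n z; rewrite ler_norml => /andP[h1 h2].
have E : 1 + nc (orb f n z) = expR (lsize (orb f n z)) by rewrite lnK ?posrE.
by rewrite E -!expRD !ler_expR; split; lra.
Qed.

Lemma lsize_orb_continuous n : nc_continuous (fun z => lsize (orb f n z)).
Proof.
move=> z e e0.
have [q q0 H] := @nc_poly_continuous R (iter_poly f n) z e e0.
exists q => // w /H; rewrite !horner_iter_poly /lsize.
set x := nc (orb f n w); set y := nc (orb f n z) => xy.
have x0 : 0 <= x by exact: nc_ge0. have y0 : 0 <= y by exact: nc_ge0.
apply: le_lt_trans xy.
have aux (u v : R) : 0 <= u -> 0 <= v -> ln (1 + u) - ln (1 + v) <= `|u - v|.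
  move=> u0 v0; have v1 : 0 < 1 + v by lra. have u1 : 0 < 1 + u by lra.
  rewrite -ln_div ?posrE //.
  apply: (@le_trans _ _ ((1 + u) / (1 + v) - 1)).
    by have := expR_ge1Dx (ln ((1 + u) / (1 + v))); rewrite lnK ?posrE ?divr_gt0 //; lra.
  rewrite lerBlDr ler_pdivrMr //.
  by have := ler_norm (u - v); have := mulr_ge0 (normr_ge0 (u - v)) v0; lra.
rewrite ler_norml; have := aux x y x0 y0; have := aux y x y0 x0; rewrite (distrC y); lra.
Qed.

Lemma green_continuous : nc_continuous green.
Proof.
have [C C0 HC] := green_bound.
move=> z e e0.
have [n Hn] := expr_unbounded (4 * (C + 1) / e) (b := d) ltac:(by have := d2; lra).
have {}Hn : 4 * (C + 1) <= e * d ^+ n.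
  by rewrite (mulrC e) -ler_pdivrMr.
have [q q0 H] := lsize_orb_continuous n z ltr01.
exists q => // w /H; have := HC n z; have := HC n w.
have := dX n; set D := d ^+ n in Hn *; rewrite !ltr_norml !ler_norml => D0 /andP[? ?] /andP[? ?] /andP[? ?].
have -> : green w - green z = (D * green w - D * green z) / D by field; rewrite gt_eqF.
by rewrite ltr_pdivlMr // ltr_pdivrMr //; lra.
Qed.

Definition filled_julia : set R[i] := [set z | exists M : R, forall n, nc (orb f n z) <= M].

Lemma filled_juliaP z : filled_julia z <-> green z = 0.
Proof.
have [A A1 HA] := orb_bounds; split=> [[M HM]|G0]; last first.
  exists A => n; have [h _] := HA n z; move: h; rewrite G0 mulr0 expR0 mulr1.
  by have := nc_ge0 (orb f n z); lra.
apply/eqP; rewrite eq_le green_ge0 andbT.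
apply: (@bounded_expr_le0 _ (A * (1 + M))) => n.
have [_ h] := HA n z; have := HM n; rewrite mulrC => hM.
apply: (@le_trans _ _ (expR (d ^+ n * green z))).
  by have := expR_ge1Dx (d ^+ n * green z); lra.
by apply: le_trans h _; rewrite ler_pM2l ?lerD2l //; lra.
Qed.

Lemma filled_julia_bounded : exists M : R, forall z, filled_julia z -> nc z <= M.
Proof.
have [A A1 HA] := orb_bounds; exists A => z /filled_juliaP G0.
by have [] := HA 0%N z; rewrite G0 mulr0 expR0 mulr1 /=; have := nc_ge0 z; lra.
Qed.

End Green.

(** * Level sets of the Green function *)

Section LocalMax.
Context {R : realType}.
Variable f : {poly R[i]}.
Hypothesis f2 : (2 <= deg f)%N.
Implicit Types z w : R[i].
Local Notation d := ((deg f)%:R : R).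

(** If all roots of [p - w] were at distance at least [r] from [z], then
    [nc (w - p.[z])] would be at least [nc (lead_coef p) * r ^+ (size p).-1]. *)
Lemma poly_open (p : {poly R[i]}) z (r : R) : (1 < size p)%N -> 0 < r ->
  exists2 e : R, 0 < e & forall w, nc (w - p.[z]) < e ->
    exists2 v, nc (v - z) < r & p.[v] = w.
Proof.
move=> p1 r0; have p0 : p != 0 by rewrite -size_poly_gt0 (ltn_trans _ p1).
have lp : 0 < nc (lead_coef p) by rewrite nc_gt0 lead_coef_eq0.
exists (nc (lead_coef p) * r ^+ (size p).-1); first by rewrite mulr_gt0 ?exprn_gt0.
move=> w; pose q := p - w%:P.
have sw : (size (- w%:P) < size p)%N.
  by rewrite size_polyN (leq_ltn_trans (size_polyC_leq1 _)).
have sq : size q = size p by rewrite size_addl.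
have lq : lead_coef q = lead_coef p by rewrite lead_coefDl.
have q0 : q != 0 by rewrite -size_poly_gt0 sq (ltn_trans _ p1).
have [rs qrs srs] := poly_roots q0.
have := nc_roots qrs z; rewrite {1}/q hornerD hornerN hornerC nc_distC => ->.
rewrite lq ltr_pM2l // -sq -srs => H; apply: contrapT => nv.
have {}nv v : v \in rs -> r <= nc (z - v).
  move=> vrs; rewrite leNgt; apply/negP => vz; apply: nv; exists v; first by rewrite nc_distC.
  by apply/eqP; move: vrs; rewrite -(mem_roots q0 qrs) hornerD hornerN hornerC subr_eq0.
move: H; apply/negP; rewrite -leNgt.
elim: rs nv {qrs srs} => [|v rs IH] nv; first by rewrite big_nil expr0.
rewrite big_cons /= exprS; apply: ler_pM; rewrite ?exprn_ge0 ?(ltW r0) //.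
  by apply: nv; rewrite mem_head.
by apply: IH => u urs; apply: nv; rewrite inE urs orbT.
Qed.

Lemma escape_radius : exists2 Q : R, 1 <= Q & forall n z, Q < nc z -> Q < nc (orb f n z).
Proof.
have [M M1 HM] := poly_lower (deg_neq0 f2).
exists (2 * M); first by lra.
elim=> [|n IH] z zQ //; rewrite orbSr; apply: IH.
have := HM z; have h : (1 + nc z) ^+ 2 <= (1 + nc z) ^+ deg f.
  by rewrite ler_eXn2l //; lra.
by move=> /(le_trans h); set a := nc z in zQ *; set b := nc f.[z]; nra.
Qed.

(** All zeros of all iterates lie in a fixed disc, and moving radially away from
    this disc multiplies the distance to each of them by at least [t > 1]. *)
Lemma green_radial : exists2 Q : R, 1 <= Q & forall z (l : R), Q < nc z -> 1 < l ->
  green f z < green f ((l%:C)%C * z).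
Proof.
have [Q Q1 HQ] := escape_radius; have [A A1 HA] := orb_bounds f2.
exists Q => // z l zQ l1; rewrite ltNge; apply/negP => gle.
pose c := (l - 1) ^+ 2 / 4; have c0 : 0 < c by rewrite divr_gt0 ?exprn_gt0 // subr_gt0.
pose t := Num.sqrt (1 + c).
have t1 : 1 < t by rewrite -[ltLHS]sqrtr1 ltr_sqrt; lra.
have step n : t ^+ (deg f ^ n)%N * nc (orb f n z) <= nc (orb f n ((l%:C)%C * z)).
  rewrite -(size_iter_poly n (deg_size f2)) -!horner_iter_poly.
  set p := iter_poly f n.
  have p0 : p != 0.
    apply/eqP => p0; have := HQ n z zQ; rewrite -horner_iter_poly -/p p0 horner0 nc0.
    by apply/negP; rewrite -leNgt; lra.
  have [rs prs <-] := poly_roots p0.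
  rewrite !(nc_roots prs) mulrCA ler_wpM2l ?nc_ge0 //.
  have : forall v, v \in rs -> nc v <= Q.
    move=> v; rewrite -(mem_roots p0 prs) horner_iter_poly => /eqP v0.
    by rewrite leNgt; apply/negP => /(HQ n); rewrite v0 nc0; apply/negP; rewrite -leNgt; lra.
  elim: rs {prs} => [|v rs IH] hrs; first by rewrite !big_nil expr0 mulr1.
  rewrite !big_cons /= exprS mulrACA; apply: ler_pM.
  - by rewrite mulr_ge0 ?nc_ge0 // sqrtr_ge0.
  - by rewrite mulr_ge0 ?exprn_ge0 ?sqrtr_ge0 // prodr_ge0 // => ? _; exact: nc_ge0.
  - rewrite -(@ler_pXn2r _ 2) ?nnegrE ?mulr_ge0 ?nc_ge0 ?sqrtr_ge0 //.
    rewrite exprMn sqr_sqrtr; last by lra.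
    have vz : nc v ^+ 2 < nc z ^+ 2.
      rewrite ltrXn2r // ?nnegrE ?nc_ge0 //.
      by rewrite (le_lt_trans _ zQ) // hrs // mem_head.
    move: vz; rewrite !nc_sqr /c; case: (z) => a b; case: (v) => x y /=.
    simpc => /=; set L := l - 1; have -> : l = L + 1 by rewrite subrK.
    have L0 : 0 < L by rewrite subr_gt0.
    move=> vz.
    have E : (L + 1) * a - x = (a - x) + L * a by ring.
    have E' : (L + 1) * b - y = (b - y) + L * b by ring.
    (* With [z = a + i b] and [v = x + i y]: [z - v] has a nonnegative scalar
       product with [z], and its modulus is at most twice that of [z]. *)
    have h1 : 0 <= (a - x) * a + (b - y) * b.
      by have := sqr_ge0 (a - x); have := sqr_ge0 (b - y); nra.
    have h2 : (a - x) ^+ 2 + (b - y) ^+ 2 <= 4 * (a ^+ 2 + b ^+ 2).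
      by have := sqr_ge0 (a + x); have := sqr_ge0 (b + y); nra.
    have h3 := mulr_ge0 (ltW L0) h1.
    have h4 := mulr_ge0 (sqr_ge0 L) (_ : 0 <= 4 * (a ^+ 2 + b ^+ 2) - ((a - x) ^+ 2 + (b - y) ^+ 2)).
    rewrite subr_ge0 in h4; have {}h4 := h4 h2.
    rewrite ?E ?E'; nra.
  - by apply: IH => u urs; apply: hrs; rewrite inE urs orbT.
have t0 : 0 < t by lra.
have bnd n : t ^+ (deg f ^ n)%N <= 2 * A * A.
  have [h1 _] := HA n ((l%:C)%C * z); have [_ h2] := HA n z.
  have h3 : 1 < nc (orb f n z) by rewrite (le_lt_trans Q1) // HQ.
  have h4 : expR (d ^+ n * green f ((l%:C)%C * z)) <= expR (d ^+ n * green f z).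
    by rewrite ler_expR ler_wpM2l // exprn_ge0.
  have := step n; move: h1 h2 h3 h4; set u := expR _; set v := expR _; set a := nc _; set b := nc _.
  have : 0 < t ^+ (deg f ^ n)%N by rewrite exprn_gt0.
  set T := t ^+ _ => T0 h1 h2 h3 h4 h5.
  have A0 : 0 < A by lra.
  have h6 : A * v <= A * (2 * A * b) by rewrite ler_pM2l //; nra.
  have h7 : A * u <= A * v by rewrite ler_pM2l.
  have h8 : T * b <= 2 * A * A * b by lra.
  by rewrite -(ler_pM2r (_ : 0 < b)) //; lra.
have [n Hn] := expr_unbounded (2 * A * A + 1) t1.
have := bnd n; have : t ^+ n <= t ^+ (deg f ^ n)%N by rewrite ler_eXn2l // ltnW // ltn_expl.
lra.
Qed.

Lemma orb_large z (Q : R) : 0 < green f z ->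
  exists N, forall n, (N <= n)%N -> Q < nc (orb f n z).
Proof.
move=> G0; have [A A1 HA] := orb_bounds f2.
have A0 : 0 < A by lra.
exists (Num.bound ((`|A * (1 + `|Q|)|) / green f z)) => n Nn.
have := archi_boundP (divr_ge0 (normr_ge0 (A * (1 + `|Q|))) (ltW G0)).
rewrite ltr_pdivrMr // => h.
have h2 : (Num.bound (`|A * (1 + `|Q|)| / green f z))%:R * green f z <= d ^+ n * green f z.
  by rewrite ler_pM2r // -natrX ler_nat (leq_trans Nn) // ltnW // ltn_expl.
have := expR_ge1Dx (d ^+ n * green f z); have [_ h3] := HA n z => h4.
have := ler_norm (A * (1 + `|Q|)) => h5.
have : A * (1 + `|Q|) < A * (1 + nc (orb f n z)) by lra.
by rewrite ltr_pM2l // ltrD2l; apply: le_lt_trans; exact: ler_norm.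
Qed.

(** An iterate of [f] is open and carries the point to the region where
    [green f] increases radially. *)
Lemma green_no_local_max z (r : R) : 0 < green f z -> 0 < r ->
  exists2 w, nc (w - z) < r & green f z < green f w.
Proof.
move=> G0 r0; have [Q Q1 HQ] := green_radial.
have [n /(_ n (leqnn n)) nQ] := orb_large Q G0.
have p1 : (1 < size (iter_poly f n))%N.
  by rewrite -subn_gt0 subn1 size_iter_poly ?deg_size // expn_gt0 (ltn_trans _ f2).
have [e e0 He] := poly_open z p1 r0.
move: He; rewrite horner_iter_poly; set y := orb f n z in nQ * => He.
have y0 : 0 < nc y by lra.
pose s := e / nc y / 2; have s0 : 0 < s by rewrite !divr_gt0.
have [|v vz] := He (((1 + s)%:C)%C * y).
  have -> : ((1 + s)%:C)%C * y - y = (s%:C)%C * y by rewrite rmorphD /= mulrDl mul1r addrC addKr.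
  rewrite ncM ncR gtr0_norm // /s mulrAC divfK ?gt_eqF //; lra.
rewrite horner_iter_poly => Ev; exists v => //.
have := HQ y (1 + s) nQ ltac:(by rewrite ltrDl).
by rewrite -Ev !green_orb // ltr_pM2l // exprn_gt0 // ltr0n (ltn_trans _ f2).
Qed.

End LocalMax.

(** * Values hit by iterates *)

Section Hitting.
Context {R : realType}.
Variable f : {poly R[i]}.
Hypothesis f2 : (2 <= deg f)%N.
Implicit Types z w : R[i].
Local Notation d := ((deg f)%:R : R).

Lemma growth_margin (A A' K E X F : R) : 1 <= A -> 0 < A' -> 0 < K -> 1 <= E ->
  A * (K + 1 + A') <= X -> E * X ^+ 2 <= A * (1 + F) -> K * E * X <= F - A' * E.
Proof.
move=> A1 A'0 K0 E1 X1 h.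
have A0 : 0 < A by lra.
have X1' : 1 <= X.
  have : 0 <= (A - 1) * (K + 1 + A') by rewrite mulr_ge0; lra.
  lra.
have EX : E <= E * X by rewrite ler_peMr //; lra.
have h2 : 0 <= (E * X) * (X - A * (K + 1 + A')) by rewrite !mulr_ge0; lra.
have h3 : A * (E * X * (K + 1 + A')) <= A * (1 + F) by lra.
move: h3; rewrite ler_pM2l // => h3.
have : A' * E <= A' * (E * X) by rewrite ler_pM2l.
lra.
Qed.

(** [two_values] applied to [orb f n - y n] and [k = y' n - y n] on a disc around
    a point [z1] close to [z0] with a higher level: at [z0] the polynomial has
    the size [expR (d ^+ n * green f z0)] of [k], at [z1] it is exponentially
    larger. *)
Lemma orbit_hits z0 (y y' : nat -> R[i]) (A' r : R) n0 :
  (forall e : R, 0 < e -> exists2 z, nc (z - z0) < e & green f z0 < green f z) ->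
  (forall n, (n0 <= n)%N -> [/\ nc (y n) <= A' * expR (d ^+ n * green f z0),
      nc (y' n) <= A' * expR (d ^+ n * green f z0) &
      expR (d ^+ n * green f z0) <= A' * nc (y n - y' n)]) ->
  0 < r -> exists n v, [/\ (n0 <= n)%N, nc (v - z0) < r & orb f n v = y n \/ orb f n v = y' n].
Proof.
move=> nlm Hy r0; have [A A1 HA] := orb_bounds f2.
have A'0 : 0 < A'.
  have [_ _] := Hy n0 (leqnn _); have := expR_gt0 (d ^+ n0 * green f z0).
  have := nc_ge0 (y n0 - y' n0); set a := nc _; set b := expR _ => a0 b0 h.
  by have : 0 < A' * a by [lra]; rewrite pmulr_lgt0 // lt_neqAle a0 andbT eq_sym; apply/eqP => a00; move: h; rewrite a00 mulr0; lra.
set t := green f z0 in nlm Hy.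
have [z1 z10 t1] := nlm (r / 4) ltac:(by rewrite divr_gt0).
pose g := green f z1 - t; have g0 : 0 < g by rewrite subr_gt0.
(* Half of the gain [g] absorbs the constants [A] and [K]. *)
pose B := expR (g / 2); have B1 : 1 < B by rewrite -expR0 ltr_expR divr_gt0.
pose K := A + 2 * A'; have K0 : 0 < K by rewrite /K; lra.
have r2 : 0 < r / 2 by rewrite divr_gt0.
have [D0 HD] := two_values (K * A') r2 B1.
have [m Hm] := expr_unbounded (A * (K + 1 + A')) B1.
pose n := maxn n0 (maxn D0 m).
have n0n : (n0 <= n)%N by rewrite leq_max leqnn.
have [yn y'n yy] := Hy n n0n.
pose E := expR (d ^+ n * t); have E1 : 1 <= E.
  by rewrite -expR0 ler_expR mulr_ge0 ?exprn_ge0 ?green_ge0.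
have ndn : (n <= deg f ^ n)%N by rewrite ltnW // ltn_expl.
pose p := iter_poly f n - (y n)%:P.
have s1 : (1 < size (iter_poly f n))%N.
  by rewrite -subn_gt0 subn1 size_iter_poly ?deg_size // expn_gt0 (ltn_trans _ f2).
have sp : (size p).-1 = (deg f ^ n)%N.
  rewrite -(size_iter_poly n (deg_size f2)) size_addl //.
  by rewrite size_polyN (leq_ltn_trans (size_polyC_leq1 _)).
have pE v : p.[v] = orb f n v - y n by rewrite hornerD hornerN hornerC horner_iter_poly.
have [|||||||v vz pv] := HD p (y' n - y n) z0 z1 (K * E).
- by rewrite sp (leq_trans _ ndn) // !leq_max leqnn !orbT.
- rewrite -nc_gt0 nc_distC; have : 0 < A' * nc (y n - y' n) by [rewrite -/E in yy; lra].
  by rewrite pmulr_rgt0.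
- apply: le_trans (nc_triangle _ _) _; rewrite ncN /K -/E in yn y'n *.
  by have : 0 < A * E by [rewrite mulr_gt0; lra]; lra.
- by rewrite -mulrA ler_pM2l // nc_distC.
- by rewrite nc_distC; lra.
- rewrite pE; apply: le_trans (nc_triangle _ _) _; rewrite ncN.
  have [h _] := HA n z0; move: h; rewrite -/t -/E => h; rewrite -/E in yn.
  have : 0 < A' * E by [rewrite mulr_gt0; lra]; rewrite /K; lra.
- rewrite sp pE; have [_ h] := HA n z1; apply: le_trans (ncB _ _); rewrite -/E in yn.
  set X := B ^+ _.
  have EX : expR (d ^+ n * green f z1) = E * X ^+ 2.
    rewrite /E /X /B -!expRM_natl -expRD; congr expR.
    by rewrite natrX /g; move: (_ ^+ n) => D; field.
  have X1 : A * (K + 1 + A') <= X.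
    apply: le_trans Hm _; rewrite ler_eXn2l //.
    by rewrite (leq_trans _ ndn) // !leq_max leqnn !orbT.
  rewrite EX in h.
  by have := growth_margin A1 A'0 K0 E1 X1 h; lra.
exists n, v; split => //; first by have := nc_dist_triangle z1 v z0; lra.
case: pv; rewrite pE => /eqP.
  by rewrite subr_eq0 => /eqP ->; left.
by rewrite (inj_eq (addIr _)) => /eqP ->; right.
Qed.

(** The sum of the roots of [f - f.[y]] does not depend on [y], so the roots
    cannot all be close to a large [y]. *)
Lemma separated_root : exists Y : R, forall y, Y <= nc y ->
  exists2 v, f.[v] = f.[y] & nc y / 2 <= nc (y - v).
Proof.
have f0 := deg_neq0 f2; have f1 := deg_size f2.
pose s := - (f`_(deg f).-1 / lead_coef f).
exists (nc s + 1) => y yY.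
pose q := f - (f.[y])%:P.
have sw : (size (- (f.[y])%:P) < size f)%N.
  by rewrite size_polyN (leq_ltn_trans (size_polyC_leq1 _)).
have sq : size q = size f by rewrite size_addl.
have lq : lead_coef q = lead_coef f by rewrite lead_coefDl.
have q0 : q != 0 by rewrite -size_poly_gt0 sq (ltn_trans _ f1).
have [rs qrs srs] := poly_roots q0; rewrite sq -/(deg f) in srs.
have sum : \sum_(x <- rs) x = s.
  rewrite /s; have : q`_(deg f).-1 = f`_(deg f).-1.
    rewrite coefB coefC; case: eqP => [|_]; last by rewrite subr0.
    by move: f2; case: (deg f) => [|[|]].
  rewrite {1}qrs coefZ -srs coefPn_prod_XsubC; last by rewrite srs -lt0n (ltn_trans _ f2).
  by move=> <-; rewrite lq mulrC mulKf ?lead_coef_eq0 // opprK.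
apply: contrapT => nv.
have {}nv v : v \in rs -> nc (y - v) <= nc y / 2.
  move=> vrs; rewrite leNgt; apply/negP => vz; apply: nv; exists v; last exact: ltW.
  by apply/eqP; move: vrs; rewrite -(mem_roots q0 qrs) hornerD hornerN hornerC subr_eq0.
have : nc (\sum_(x <- rs) (y - x)) <= d * (nc y / 2).
  apply: le_trans (nc_sum _ _) _; rewrite -srs.
  elim: rs nv {qrs srs sum} => [|v rs IH] nv; first by rewrite big_nil mul0r.
  rewrite big_cons /= -natr1 mulrDl mul1r addrC lerD ?nv ?mem_head //.
  by apply: IH => u urs; apply: nv; rewrite inE urs orbT.
rewrite sumrB sum big_const_seq count_predT srs iter_addr_0 => h.
have : nc (y *+ deg f) = d * nc y by rewrite ncMn mulr_natl.
have := ncB (y *+ deg f) s.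
have d2 : 2 <= d by rewrite ler_nat.
have := nc_ge0 s; nra.
Qed.

Variable A : set R[i].
Hypothesis Af : forall z, A z <-> A f.[z].

Lemma invariant_orb n z : A z <-> A (orb f n z).
Proof. by elim: n => [|n IH] //; rewrite orbS; split => [/IH.1 /(Af _).1|/(Af _).2 /IH.2]. Qed.

(** [orbit_hits] with constant sequences: at level [0] the scale
    [expR (d ^+ n * green f z0)] is [1]. *)
Lemma boundary_hits x1 x2 z0 (r : R) : A x1 -> A x2 -> x1 != x2 ->
  green f z0 = 0 ->
  (forall e : R, 0 < e -> exists2 z, nc (z - z0) < e & 0 < green f z) ->
  0 < r -> exists2 v, nc (v - z0) < r & A v.
Proof.
move=> A1 A2 x12 G0 nlm r0.
have x0 : 0 < nc (x1 - x2) by rewrite nc_gt0 subr_eq0.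
have [|n|n [v [_ vz]]] := @orbit_hits z0 (fun=> x1) (fun=> x2)
  (nc x1 + nc x2 + (nc (x1 - x2))^-1) r 0 _ _ r0.
- by rewrite G0.
- move=> _; rewrite G0 mulr0 expR0 mulr1.
  have := nc_ge0 x1; have := nc_ge0 x2; have i0 : 0 < (nc (x1 - x2))^-1 by rewrite invr_gt0.
  move=> a b; split; [lra|lra|rewrite mulrDl mulVf ?gt_eqF //].
  by rewrite lerDr mulr_ge0 ?addr_ge0 ?nc_ge0.
- by move=> h; exists v => //; apply/(invariant_orb n); case: h => ->.
Qed.

(** [orbit_hits] for [y n = orb f n x] and [y' n] another preimage of
    [orb f n.+1 x], far from [y n] by [separated_root]. *)
Lemma level_hits x w (r : R) : A x -> 0 < green f x -> green f w = green f x ->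
  0 < r -> exists2 v, nc (v - w) < r & A v.
Proof.
move=> Ax Gx Gw r0; have [Y HY] := separated_root.
have /choice[y' Hy'] : forall n, exists v, Y <= nc (orb f n x) ->
    f.[v] = f.[orb f n x] /\ nc (orb f n x) / 2 <= nc (orb f n x - v).
  move=> n; have [/HY[v ? ?]|h] := leP Y (nc (orb f n x)); first by exists v.
  by exists 0.
have [N HN] := orb_large f2 (Num.max Y 1) Gx.
have [B B1 HB] := orb_bounds f2.
have d0 : d != 0 by rewrite pnatr_eq0 -lt0n (ltn_trans _ f2).
have Yn n : (N <= n)%N -> Y <= nc (orb f n x) /\ 1 <= nc (orb f n x).
  by move=> /HN; rewrite gt_max => /andP[/ltW ? /ltW ?].
have [e e0|n Nn|n [v [Nn vw h]]] := @orbit_hits w (orb f ^~ x) y' (4 * B) r N _ _ r0.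
- by apply: green_no_local_max => //; rewrite Gw.
- have [h1 h2] := Yn n Nn; have [h3 h4] := Hy' n h1.
  have [h5 h6] := HB n x; rewrite Gw.
  have Gy : green f (y' n) = d ^+ n * green f x.
    by apply: (mulfI d0); rewrite -green_poly // h3 green_poly // green_orb.
  have [h7 _] := HB 0%N (y' n); rewrite Gy expr0 mul1r /= in h7.
  have E0 := expR_gt0 (d ^+ n * green f x).
  have BE : 0 < B * expR (d ^+ n * green f x) by rewrite mulr_gt0; lra.
  split; rewrite -?mulrA; first by lra.
    by have := nc_ge0 (y' n); lra.
  apply: le_trans h6 _.
  have : B * nc (orb f n x) / 2 <= B * nc (orb f n x - y' n) by rewrite -mulrA ler_wpM2l //; lra.
  have : B <= B * nc (orb f n x) by rewrite ler_peMr //; lra.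
  by lra.
- exists v => //; apply/(invariant_orb n).
  case: h => ->; first exact: (invariant_orb n x).1.
  have [h1 _] := Yn n Nn; have [h3 _] := Hy' n h1.
  by apply: (Af _).2; rewrite h3; apply: (Af _).1; exact: (invariant_orb n x).1.
Qed.

End Hitting.

(** * Expansion of the Green function at infinity *)

Section Asymptotics.
Context {R : realType}.
Implicit Types (p : {poly R[i]}) (z w : R[i]).

Lemma poly_lead p : (1 < size p)%N -> exists2 B : R, 0 <= B & forall z, 1 <= nc z ->
  nc (p.[z] - lead_coef p * z ^+ deg p) <= B * nc z ^+ (deg p).-1.
Proof.
move=> p1; pose h := p - lead_coef p *: 'X^(deg p).
have hs : (size h <= deg p)%N.
  apply/leq_sizeP => j; rewrite leq_eqVlt => /orP[/eqP <-|pj].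
    by rewrite coefB coefZ coefXn eqxx mulr1 subrr.
  rewrite coefB coefZ coefXn gtn_eqF // mulr0 subr0 nth_default //.
  by rewrite (leq_trans _ pj) // /deg leqSpred.
have [M M1 HM] := poly_upper h.
exists (M * 2 ^+ (deg p).-1); first by rewrite mulr_ge0 ?exprn_ge0 //; lra.
move=> z z1; have := HM z.
have -> : h.[z] = p.[z] - lead_coef p * z ^+ deg p.
  by rewrite hornerD hornerN hornerZ hornerXn.
have : (1 + nc z) ^+ deg h <= (2 * nc z) ^+ (deg p).-1.
  apply: (@le_trans _ _ ((2 * nc z) ^+ deg h)).
    rewrite lerXn2r ?nnegrE; lra.
  by rewrite ler_weXn2l //; [lra|have := leq_sub2r 1 hs; rewrite !subn1].
have M0 : 0 <= M by lra.
rewrite exprMn => h1 h2; rewrite -mulrA.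
apply: le_trans (ler_wpM2l M0 h1); apply: le_trans h2.
by rewrite lerDr.
Qed.

Lemma ln_near1 (y x : R) : `|y - 1| <= x -> x <= 1 / 2 -> `|ln y| <= 2 * x.
Proof.
rewrite ler_norml => /andP[h1 h2] x2; have y0 : 0 < y by lra.
have h3 := expR_ge1Dx (ln y); rewrite lnK ?posrE // in h3.
have h4 := expR_ge1Dx (- ln y); rewrite expRN lnK ?posrE // in h4.
have : y^-1 <= 1 + 2 * x by rewrite -div1r ler_pdivrMr //; nra.
rewrite ler_norml; lra.
Qed.

End Asymptotics.

Section GreenAsymptotics.
Context {R : realType}.
Variable f : {poly R[i]}.
Hypothesis f2 : (2 <= deg f)%N.
Implicit Types z w : R[i].
Local Notation d := ((deg f)%:R : R).

Lemma ln_poly_asym : exists C Q : R, [/\ 0 <= C, 1 <= Q & forall w, Q <= nc w ->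
  `|ln (nc f.[w]) - ln (nc (lead_coef f)) - d * ln (nc w)| <= C / nc w].
Proof.
have [B B0 HB] := poly_lead (deg_size f2).
set a := nc (lead_coef f).
have a0 : 0 < a by rewrite nc_gt0 lead_coef_eq0 deg_neq0.
exists (2 * (B / a)), (1 + 2 * (B / a)); have Ba : 0 <= B / a by rewrite divr_ge0 // ltW.
split=> [||w wQ]; [lra|lra|].
have w1 : 1 <= nc w by lra.
have w0 : 0 < nc w by lra.
have aw : 0 < a * nc w ^+ deg f by rewrite mulr_gt0 ?exprn_gt0.
pose y := nc f.[w] / (a * nc w ^+ deg f).
have hy : `|y - 1| <= B / a / nc w.
  have -> : y - 1 = (nc f.[w] - nc (lead_coef f * w ^+ deg f)) / (a * nc w ^+ deg f).
    by rewrite ncM ncX mulrBl divff ?gt_eqF.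
  have -> : B / a / nc w = B * nc w ^+ (deg f).-1 / (a * nc w ^+ deg f).
    have [k ->] : exists k, deg f = k.+1.
      by exists (deg f).-1; rewrite prednK // (ltn_trans _ f2).
    rewrite exprS /=.
    by field; rewrite !gt_eqF // exprn_gt0.
  rewrite normrM (gtr0_norm (_ : 0 < (a * _)^-1)) ?invr_gt0 // ler_pM2r ?invr_gt0 //.
  apply: le_trans (HB w w1); rewrite ler_norml.
  have := ncB f.[w] (lead_coef f * w ^+ deg f).
  have := ncB (lead_coef f * w ^+ deg f) f.[w]; rewrite (nc_distC _ f.[w]); lra.
have fw0 : 0 < nc f.[w].
  have : 0 < y.
    have : B / a / nc w < 1 by rewrite ltr_pdivrMr; lra.
    by move: hy; rewrite ler_norml => /andP[]; lra.
  by rewrite pmulr_lgt0 // invr_gt0.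
have : B / a / nc w <= 1 / 2 by rewrite ler_pdivrMr; lra.
move=> /(ln_near1 hy); rewrite ln_div ?posrE // lnM ?posrE ?exprn_gt0 // lnXn // mulr_natl.
have -> : 2 * (B / a) / nc w = B / a / nc w *+ 2 by rewrite -mulrA mulr_natl.
by rewrite opprD addrA mulr_natl.
Qed.

(** The error [E] of the expansion satisfies [d * E w = E f.[w] + O(1 / nc w)] by
    [ln_poly_asym], and [f] increases the modulus, so [E] is at most a geometric
    sum of terms [C / nc w]. *)
Lemma green_asym : exists (c C Q : R), [/\ 0 <= C, 1 <= Q & forall w, Q <= nc w ->
  `|green f w - ln (nc w) - c| <= C / nc w].
Proof.
have [C0 [Q0 [C00 Q01 HQ]]] := ln_poly_asym.
have [Q1 Q11 HQ1] := green_radial f2.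
have [M M1 HM] := poly_lower (deg_neq0 f2).
have [D D0 HD] := green_bound f2.
have d2 : 2 <= d by rewrite ler_nat.
have d0 : 0 < d by lra.
(* The constant for which the equation [d * E w = E f.[w] + O(1 / nc w)] has
   no constant term. *)
pose c := ln (nc (lead_coef f)) / (d - 1).
pose Q := Q0 + 2 * M.
have grow w : Q <= nc w -> nc w <= nc f.[w].
  move=> wQ; have := HM w; have h : (1 + nc w) ^+ 2 <= (1 + nc w) ^+ deg f.
    by rewrite ler_eXn2l //; rewrite /Q in wQ; lra.
  move=> /(le_trans h); rewrite /Q in wQ; set a := nc w in wQ *; set b := nc f.[w]; nra.
pose E w := green f w - ln (nc w) - c.
exists c, C0, Q; split => //; first by rewrite /Q; lra.
pose B := D + 1 + `|c|.
have B0 : 0 <= B by rewrite /B addr_ge0 // addr_ge0.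
have bnd w : 1 <= nc w -> `|E w| <= B.
  move=> w1; have := HD 0%N w; rewrite expr0 mul1r /= /lsize => h.
  have h1 : `|ln (1 + nc w) - ln (nc w)| <= 1.
    have w0 : 0 < nc w by lra. have w0' : 0 < 1 + nc w by lra.
    rewrite ger0_norm; last by rewrite subr_ge0 ler_ln ?posrE; lra.
    rewrite -ln_div ?posrE //; have := expR_ge1Dx (ln ((1 + nc w) / nc w)).
    rewrite lnK ?posrE ?divr_gt0 //.
    have : (1 + nc w) / nc w <= 2 by rewrite ler_pdivrMr //; lra.
    lra.
  have -> : E w = (green f w - ln (1 + nc w)) + (ln (1 + nc w) - ln (nc w)) - c by rewrite /E; ring.
  rewrite (le_trans (ler_normB _ _)) // lerD2r (le_trans (ler_normD _ _)) //; lra.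
have step n w : Q <= nc w -> `|E w| <= C0 / nc w + B / d ^+ n.
  elim: n w => [|n IH] w wQ.
    rewrite expr0 divr1; apply: (le_trans (bnd _ _)); first by rewrite /Q in wQ; lra.
    by rewrite lerDr divr_ge0 // nc_ge0.
  have w0 : 0 < nc w by rewrite /Q in wQ; lra.
  have fw := grow w wQ; have {}IH := IH f.[w] (le_trans wQ fw).
  have EE : d * E w = E f.[w] + (ln (nc f.[w]) - ln (nc (lead_coef f)) - d * ln (nc w)).
    have -> : ln (nc (lead_coef f)) = c * (d - 1).
      by rewrite /c divfK // gt_eqF // subr_gt0; lra.
    by rewrite /E green_poly //; ring.
  have h1 : d * `|E w| <= C0 / nc f.[w] + B / d ^+ n + C0 / nc w.
    rewrite -[d in d * _](ger0_norm (ltW d0)) -normrM EE (le_trans (ler_normD _ _)) // lerD //.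
    by apply: HQ; rewrite /Q in wQ; lra.
  have h2 : C0 / nc f.[w] <= C0 / nc w.
    by rewrite ler_wpM2l // lef_pV2 // posrE; lra.
  rewrite -(ler_pM2l d0); apply: le_trans h1 _.
  have -> : d * (C0 / nc w + B / d ^+ n.+1) = d * (C0 / nc w) + B / d ^+ n.
    by rewrite exprS; field; rewrite !gt_eqF // exprn_gt0.
  have : 0 <= C0 / nc w by rewrite divr_ge0 // ltW.
  nra.
move=> w wQ; rewrite -subr_le0.
apply: (@bounded_expr_le0 _ _ f2 _ B) => n.
have := step n w wQ; rewrite -/(E w) -lerBlDl ler_pdivlMr ?exprn_gt0 //.
Qed.

End GreenAsymptotics.

(** * Comparison of two filled Julia sets *)

Section FilledJulia.
Context {R : realType}.
Variables f g : {poly R[i]}.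
Hypotheses (f2 : (2 <= deg f)%N) (g2 : (2 <= deg g)%N).
Implicit Types z w : R[i].

(** At a point of [K_f] where [green g] is maximal and positive, [K_f] is not a
    neighborhood of this point by [green_no_local_max]. *)
Lemma filled_le :
  (forall z, green f z = 0 ->
    (forall e : R, 0 < e -> exists2 w, nc (w - z) < e & 0 < green f w) ->
    green g z = 0) ->
  forall z, green f z = 0 -> green g z = 0.
Proof.
move=> H z0 Gz0; apply/eqP; rewrite eq_le green_ge0 // andbT leNgt; apply/negP => Gg.
have [M HM] := filled_julia_bounded f2.
have le0 z : green f z <= 0 -> green f z = 0.
  by move=> h; apply/eqP; rewrite eq_le h green_ge0.
have [|||z /= Kz zmax] := @evt_max R [set z | green f z <= 0] M _ _ _ _ (green_continuous g2).
- by exists z0; rewrite /= Gz0.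
- by move=> z /le0 /(filled_juliaP f2) /HM.
- by apply: nc_closed_le; exact: green_continuous.
have Ggz : 0 < green g z by apply: lt_le_trans Gg _; apply: zmax; rewrite /= Gz0.
have : ~ (forall e : R, 0 < e -> exists2 w, nc (w - z) < e & 0 < green f w).
  by move=> /(H z (le0 z Kz)) h; move: Ggz; rewrite h ltxx.
apply => e e0; have [w wz Gw] := green_no_local_max g2 Ggz e0.
exists w => //; rewrite ltNge; apply/negP => /zmax; rewrite leNgt Gw //.
Qed.

End FilledJulia.

(** * Polynomials of the same degree on rays *)

Section Rays.
Context {R : realType}.
Implicit Types (P Q : {poly R[i]}) (z w e : R[i]).

Definition dominates_on_ray P Q e := nc e = 1 /\
  forall B : R, exists2 r0 : R, 0 < r0 &
    forall r, r0 <= r -> B <= nc P.[(r%:C)%C * e] - nc Q.[(r%:C)%C * e].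

Lemma dominates_of_bound P Q e k (c C : R) : nc e = 1 -> 0 < c -> 0 <= C ->
  (forall r, 1 <= r -> c * r ^+ k.+1 - C * r ^+ k <=
     nc P.[(r%:C)%C * e] - nc Q.[(r%:C)%C * e]) -> dominates_on_ray P Q e.
Proof.
move=> e1 c0 C0 H; split => // B; exists (1 + (C + `|B|) / c).
  by rewrite ltr_pwDl // divr_ge0 ?addr_ge0 // ltW.
move=> r hr; have r1 : 1 <= r.
  by apply: le_trans hr; rewrite lerDl divr_ge0 ?addr_ge0 // ltW.
apply: le_trans (H r r1).
have h : C + `|B| <= c * r by rewrite mulrC -ler_pdivrMr //; lra.
have -> : c * r ^+ k.+1 - C * r ^+ k = (c * r - C) * r ^+ k by rewrite exprS; ring.
have rk : 1 <= r ^+ k by rewrite exprn_ege1.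
by have := ler_norm B; have := normr_ge0 B; nra.
Qed.

Lemma dominates_lead P Q : size P = size Q -> (1 < size P)%N ->
  nc (lead_coef Q) < nc (lead_coef P) -> dominates_on_ray P Q 1.
Proof.
move=> PQ P1 ltPQ; have Q1 : (1 < size Q)%N by rewrite -PQ.
have [B B0 HB] := poly_lead P1; have [C C0 HC] := poly_lead Q1.
have dPQ : deg Q = deg P by rewrite /deg PQ.
have [k kE] : exists k, deg P = k.+1.
  by exists (deg P).-1; rewrite prednK // /deg -subn1 subn_gt0.
apply: (@dominates_of_bound _ _ _ k (nc (lead_coef P) - nc (lead_coef Q)) (B + C)).
- exact: nc1.
- by rewrite subr_gt0.
- exact: addr_ge0.
move=> r r1; rewrite mulr1.
have nr : nc ((r%:C)%C : R[i]) = r by rewrite ncR ger0_norm //; lra.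
have := HB (r%:C)%C; have := HC (r%:C)%C; rewrite dPQ kE nr /= => /(_ r1) h1 /(_ r1) h2.
have := ncB (lead_coef P * (r%:C)%C ^+ k.+1) P.[(r%:C)%C].
have := ncB Q.[(r%:C)%C] (lead_coef Q * (r%:C)%C ^+ k.+1).
rewrite (nc_distC _ P.[_]) !(ncM (lead_coef _)) !ncX nr.
by rewrite mulrBl; lra.
Qed.

(** With [U = u *: Q] and [D = P - U], the ray is chosen so that the leading term
    of [D] is there a positive multiple [s] of that of [U]. Then
    [nc P - nc Q = s * nc U] up to lower order terms, which is of the order of
    the nonconstant polynomial [D]. *)
Lemma dominates_equal_lead P Q (u : R[i]) : size P = size Q -> (1 < size P)%N ->
  nc u = 1 -> lead_coef P = u * lead_coef Q -> (1 < size (P - u *: Q)%R)%N ->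
  exists e, dominates_on_ray P Q e.
Proof.
move=> PQ P1 u1 lPQ D1; set D := P - u *: Q in D1.
have u0 : u != 0 by rewrite -nc_gt0 u1.
pose U := u *: Q.
have sU : size U = size P by rewrite size_scale.
have lU : lead_coef U = lead_coef P by rewrite lead_coefZ.
have U1 : (1 < size U)%N by rewrite sU.
have PUD : P = U + D by rewrite /D addrC subrK.
have DP : (size D < size P)%N.
  rewrite -(prednK (ltn_trans _ P1 : (0 < size P)%N)) // ltnS; apply/leq_sizeP => j.
  rewrite leq_eqVlt => /orP[/eqP <-|pj].
    by rewrite coefB -/(lead_coef P) -lU lead_coefE sU subrr.
  rewrite coefB !nth_default ?subr0 //; last by rewrite (leq_trans (leqSpred _)).
  by rewrite size_scale // -PQ (leq_trans (leqSpred _)).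
have [k kE] : exists k, deg D = k.+1.
  by exists (deg D).-1; rewrite prednK // /deg -subn1 subn_gt0.
have [m mE] : exists m, deg P = (k.+1 + m.+1)%N.
  exists (deg P - deg D).-1; rewrite -kE prednK ?subnKC //.
    by rewrite /deg -!subn1 leq_sub2r // ltnW.
  by rewrite subn_gt0 /deg -!subn1 ltn_sub2r.
have dU : deg U = (k.+1 + m.+1)%N by rewrite /deg sU -/(deg P).
set a := lead_coef P in lU *; pose b := lead_coef D.
have b0 : b != 0 by rewrite lead_coef_eq0 -size_poly_gt0 (ltn_trans _ D1).
have a0 : a != 0 by rewrite lead_coef_eq0 -size_poly_gt0 (ltn_trans _ P1).
have na : 0 < nc a by rewrite nc_gt0. have nb : 0 < nc b by rewrite nc_gt0.
pose c := nc b / nc a; have c0 : 0 < c by rewrite divr_gt0.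
have cC : (c%:C)%C != 0 :> R[i] by rewrite -nc_gt0 ncR gtr0_norm.
pose v := b / (a * (c%:C)%C).
have v1 : nc v = 1.
  by rewrite !(ncM, ncV) ncR gtr0_norm // /c; field; rewrite !gt_eqF.
have [e e1 em] := unit_root (ltn0Sn m) v1.
have [B1 B10 HB1] := poly_lead D1; have [B2 B20 HB2] := poly_lead U1.
exists e; apply: (@dominates_of_bound _ _ _ k (nc b) (B1 + 2 * c * B2)) => //.
  by have := mulr_ge0 (ltW c0) B20; lra.
move=> r r1; have r0 : 0 < r by lra.
set z := (r%:C)%C * e; have nz : nc z = r by rewrite nc_scale_unit // ltW.
have z1 : 1 <= nc z by rewrite nz.
pose s := c / r ^+ m.+1; have s0 : 0 < s by rewrite divr_gt0 ?exprn_gt0.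
have := HB1 z z1; have := HB2 z z1; rewrite lU nz kE dU addnS /= => hU hD.
have sr : s * r ^+ (k.+1 + m) = c * r ^+ k.
  by rewrite /s addSnnS exprD; field; rewrite gt_eqF // exprn_gt0.
have main : (s%:C)%C * (a * z ^+ (k.+1 + m.+1)) = b * z ^+ k.+1.
  rewrite exprD.
  have -> : z ^+ m.+1 = (r%:C)%C ^+ m.+1 * v by rewrite /z exprMn em.
  have E : ((s%:C)%C : R[i]) * (r%:C)%C ^+ m.+1 = (c%:C)%C.
    by rewrite -rmorphXn -rmorphM /s divfK // expf_neq0 // gt_eqF.
  have -> : (s%:C)%C * (a * (z ^+ k.+1 * ((r%:C)%C ^+ m.+1 * v))) =
     ((s%:C)%C * (r%:C)%C ^+ m.+1) * a * v * z ^+ k.+1 by ring.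
  by rewrite E (mulrC _ a) /v [_ * (b / _)]mulrC divfK // mulf_neq0.
have Un : nc U.[z] = nc Q.[z] by rewrite hornerZ ncM u1 mul1r.
have PE : P.[z] = ((1 + s)%:C)%C * U.[z] + ((D.[z] - b * z ^+ k.+1) - (s%:C)%C * (U.[z] - a * z ^+ (k.+1 + m.+1))).
  by rewrite mulrBr main PUD hornerD rmorphD /=; ring.
have := ncB (P.[z] - ((D.[z] - b * z ^+ k.+1) - (s%:C)%C * (U.[z] - a * z ^+ (k.+1 + m.+1)))) (- ((D.[z] - b * z ^+ k.+1) - (s%:C)%C * (U.[z] - a * z ^+ (k.+1 + m.+1)))).
rewrite opprK subrK {1}PE addrK ncN ncM ncR gtr0_norm; last by lra.
have := nc_triangle (D.[z] - b * z ^+ k.+1) (- ((s%:C)%C * (U.[z] - a * z ^+ (k.+1 + m.+1)))).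
rewrite ncN (ncM (s%:C)%C) ncR gtr0_norm //.
have := ncB (a * z ^+ (k.+1 + m.+1)) U.[z]; rewrite (nc_distC _ U.[z]) (ncM a) ncX nz.
rewrite addnS in hU *; set X := nc (U.[z] - _) in hU *; set Y := nc (D.[z] - _) in hD *.
rewrite Un; set q := nc Q.[z]; set p := nc P.[z].
set W := nc (_ - _ * _) => h1 h2 h3.
have sX : s * X <= B2 * (c * r ^+ k).
  by rewrite -sr; have := ler_wpM2l (ltW s0) hU; lra.
have sa : s * (nc a * r ^+ (k.+1 + m).+1) = nc b * r ^+ k.+1.
  rewrite exprS exprS.
  have -> : s * (nc a * (r * r ^+ (k.+1 + m))) = nc a * r * (s * r ^+ (k.+1 + m)) by ring.
  by rewrite sr /c; field; rewrite gt_eqF.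
have : s * (nc a * r ^+ (k.+1 + m).+1) - s * q <= s * X.
  by rewrite -mulrBr ler_wpM2l // ltW.
rewrite sa; lra.
Qed.

Lemma ray_dichotomy P Q : size P = size Q -> (1 < size P)%N ->
  (exists u c, nc u = 1 /\ P = u *: Q + c%:P) \/
  (exists e, dominates_on_ray P Q e \/ dominates_on_ray Q P e).
Proof.
move=> PQ P1; have Q1 : (1 < size Q)%N by rewrite -PQ.
have [h|h|h] := ltgtP (nc (lead_coef P)) (nc (lead_coef Q)).
- by right; exists 1; right; apply: dominates_lead.
- by right; exists 1; left; apply: dominates_lead.
pose u := lead_coef P / lead_coef Q.
have lQ : lead_coef Q != 0 by rewrite lead_coef_eq0 -size_poly_gt0 (ltn_trans _ Q1).
have u1 : nc u = 1 by rewrite ncM ncV h divff // gt_eqF // nc_gt0.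
have lP : lead_coef P = u * lead_coef Q by rewrite /u divfK.
have [D1|D1] := leqP (size (P - u *: Q)) 1.
  left; exists u, (P - u *: Q)`_0; split => //.
  by rewrite -(size1_polyC D1) addrC subrK.
by right; have [e He] := dominates_equal_lead PQ P1 u1 lP D1; exists e; left.
Qed.

End Rays.

(** * Invariant sets in the basin of infinity *)

Section AllOrNothing.
Context {R : realType}.
Variable f : {poly R[i]}.
Hypothesis f2 : (2 <= deg f)%N.
Implicit Types (P Q : {poly R[i]}) (z w e : R[i]).
Local Notation d := ((deg f)%:R : R).

Lemma poly_ray_large Q e (B : R) : (1 < size Q)%N -> nc e = 1 ->
  exists r0 : R, forall r, r0 <= r -> B <= nc Q.[(r%:C)%C * e].
Proof.
move=> Q1 e1; have Q0 : Q != 0 by rewrite -size_poly_gt0 (ltn_trans _ Q1).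
have [M M1 HM] := poly_lower Q0.
exists (M * (1 + `|B|)) => r hr.
have r0 : 0 <= r by apply: le_trans hr; rewrite mulr_ge0 ?addr_ge0 //; lra.
have := HM ((r%:C)%C * e); rewrite nc_scale_unit // => h.
have : (1 + r) ^+ 1 <= (1 + r) ^+ deg Q.
  by rewrite ler_weXn2l ?lerDl // /deg -subn1 subn_gt0.
rewrite expr1 => h2; have M0 : 0 < M by lra.
have : M * (1 + `|B|) <= M * (1 + nc Q.[(r%:C)%C * e]) by lra.
by rewrite ler_pM2l // lerD2l; apply: le_trans; exact: ler_norm.
Qed.

(** By [green_asym] the difference of the two values of [green f] is
    [ln (nc P / nc Q)] up to [O(1 / nc P)]. The first term is at least
    [(nc P - nc Q) / nc P], and the numerator tends to infinity. *)
Lemma green_on_ray P Q e : size P = size Q -> (1 < size P)%N -> dominates_on_ray P Q e ->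
  exists r0 B : R, forall r, r0 <= r ->
    green f Q.[(r%:C)%C * e] < green f P.[(r%:C)%C * e] /\
    green f P.[(r%:C)%C * e] <= green f Q.[(r%:C)%C * e] + B.
Proof.
move=> PQ P1 [e1 ray]; have Q1 : (1 < size Q)%N by rewrite -PQ.
have [c [C [X [C0 X1 HX]]]] := green_asym f2.
have [D D0 HD] := green_bound f2.
have Q0 : Q != 0 by rewrite -size_poly_gt0 (ltn_trans _ Q1).
have [M M1 HM] := poly_upper P; have [N N1 HN] := poly_lower Q0.
have [r1 H1] := poly_ray_large X Q1 e1.
have [r2 _ H2] := ray (1 + C + 2 * (M * N) * C).
exists (Num.max r1 r2), (ln (M * N) + 2 * D) => r; rewrite ge_max => /andP[/H1 q1 /H2 pq].
set p := P.[_] in pq *; set q := Q.[_] in q1 pq *.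
have MN : 1 <= M * N by nra.
have MN0 : 0 <= M * N * C by rewrite mulr_ge0 // (le_trans ler01).
have q0 : 0 < nc q by lra.
have p0 : 0 < nc p by lra.
have le1 : 1 + nc p <= M * N * (1 + nc q).
  have := HM ((r%:C)%C * e); have := HN ((r%:C)%C * e).
  rewrite /deg PQ -/p -/q => h1 h2; apply: le_trans h2 _.
  by rewrite -mulrA ler_wpM2l //; lra.
split.
  have := HX q q1; have := HX p ltac:(lra); rewrite !ler_norml => /andP[h1 _] /andP[_ h2].
  have h3 : (nc p - nc q) / nc p <= ln (nc p) - ln (nc q).
    have := expR_ge1Dx (ln (nc q / nc p)); rewrite lnK ?posrE ?divr_gt0 //.
    rewrite ln_div ?posrE // mulrBl divff ?gt_eqF //; lra.
  have h4 : C / nc q <= 2 * (M * N) * C / nc p.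
    rewrite ler_pdivrMr // mulrAC ler_pdivlMr //.
    have : C * nc p <= C * (2 * (M * N) * nc q) by rewrite ler_wpM2l //; nra.
    lra.
  have h5 : 0 < (nc p - nc q - C - 2 * (M * N) * C) / nc p by rewrite divr_gt0 //; lra.
  by move: h5; rewrite !mulrBl in h3 *; lra.
have := HD 0%N p; have := HD 0%N q; rewrite expr0 !mul1r /= /lsize !ler_norml.
move=> /andP[h1 _] /andP[_ h2].
have : ln (1 + nc p) <= ln (M * N) + ln (1 + nc q).
  have MN' : 0 < M * N by lra. have q0' : 0 < 1 + nc q by lra.
  by rewrite -lnM ?posrE // ler_ln ?posrE ?mulr_gt0 //; lra.
lra.
Qed.

Lemma green_ray_continuous Q e : nc e = 1 ->
  real_continuous (fun r => green f Q.[(r%:C)%C * e]).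
Proof.
move=> e1 x eps eps0.
have [a a0 Ha] := green_continuous f2 Q.[(x%:C)%C * e] eps0.
have [b b0 Hb] := poly_continuous_at Q ((x%:C)%C * e) a0.
exists b => // y xy; apply: Ha; apply: Hb.
by rewrite -mulrBl -rmorphB ncM ncR e1 mulr1.
Qed.

Lemma green_ray_surj Q e (r0 v : R) : (1 < size Q)%N -> nc e = 1 ->
  green f Q.[(r0%:C)%C * e] <= v ->
  exists2 r, r0 <= r & green f Q.[(r%:C)%C * e] = v.
Proof.
move=> Q1 e1 v0; have [D D0 HD] := green_bound f2.
have [r1 H1] := poly_ray_large (expR (v + D)) Q1 e1.
pose r2 := Num.max r0 r1.
have r02 : r0 <= r2 by rewrite le_max lexx.
have [|r /andP[? ?] ?] := real_IVT r02 (green_ray_continuous Q e1) (v := v); last by exists r.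
rewrite v0 /=.
have := H1 r2 ltac:(by rewrite le_max lexx orbT); set q := Q.[_] => hq.
have := HD 0%N q; rewrite expr0 mul1r /= /lsize ler_norml => /andP[h _].
have : v + D <= ln (1 + nc q).
  have e0 := expR_gt0 (v + D).
  rewrite -[leLHS]expRK ler_ln ?posrE //; lra.
lra.
Qed.

Variable A : set R[i].
Hypothesis Af : forall z, A z <-> A f.[z].
Hypothesis Acl : nc_closed A.

Lemma level_saturated x w : A x -> 0 < green f x -> green f w = green f x -> A w.
Proof.
move=> Ax Gx Gw; apply: contrapT => /Acl[r r0 H].
by have [v vw Av] := level_hits f2 Af Ax Gx Gw r0; exact: H Av.
Qed.

(** [x] is a point of [A] with the highest level not above that of [w0]; since [A]
    is closed and is a union of level sets, this level is below that of [w0].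
    For large [n] the level [d ^+ n * green f x] is attained by [Q] on the ray,
    and the value of [P] at the same point of the ray is in [A], with a level
    that is higher by a bounded amount. Pulled back by [orb f n] this is a point
    of [A] with a level between those of [x] and [w0]. *)
Lemma all_or_nothing P Q e : size P = size Q -> (1 < size P)%N -> dominates_on_ray P Q e ->
  (forall z, A z <-> A P.[z]) -> (forall z, A z <-> A Q.[z]) ->
  (exists2 x, A x & 0 < green f x) -> forall w, 0 < green f w -> A w.
Proof.
move=> PQ P1 ray AP AQ [x0 Ax0 Gx0] w0 Gw0; apply: contrapT => nAw.
have Q1 : (1 < size Q)%N by rewrite -PQ.
have e1 := ray.1.
have [r0 [B HB]] := green_on_ray PQ P1 ray.
have d0 : 0 < d by rewrite ltr0n (ltn_trans _ f2).
have dX n : 0 < d ^+ n by rewrite exprn_gt0.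
have d1 : 1 < d by rewrite ltr1n.
have surj n w : exists2 y, orb f n y = w & A y <-> A w.
  have [|y yw] := @poly_surj R (iter_poly f n) w.
    by rewrite -subn_gt0 subn1 size_iter_poly ?deg_size // expn_gt0 (ltn_trans _ f2).
  by exists y; rewrite -?yw horner_iter_poly //; exact: invariant_orb.
pose S := A `&` [set z | green f z <= green f w0].
have [M HM] : exists M : R, forall z, S z -> nc z <= M.
  have [D D0 HD] := green_bound f2; exists (expR (green f w0 + D)) => z [_ /= zw].
  have := HD 0%N z; rewrite expr0 mul1r /= /lsize ler_norml => /andP[h _].
  have z0 : 0 < 1 + nc z by rewrite ltr_pwDl ?nc_ge0.
  have : 1 + nc z <= expR (green f w0 + D) by rewrite -[leLHS]lnK ?posrE // ler_expR; lra.
  lra.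
have [||x [Ax /= Gxw] xmax] := @evt_max R S M _ _ HM _ (green_continuous f2).
- have [n Hn] := expr_unbounded (green f x0 / green f w0) d1.
  have [y yx [_ /(_ Ax0) Ay]] := surj n x0; exists y; split => //=.
  rewrite -(ler_pM2l (dX n)) -green_orb // yx.
  by rewrite -ler_pdivrMr.
- by apply: nc_closedI => //; apply: nc_closed_le; exact: green_continuous.
have Gx : 0 < green f x.
  have [n Hn] := expr_unbounded (green f x0 / green f w0) d1.
  have [y yx [_ /(_ Ax0) Ay]] := surj n x0.
  have Gy : d ^+ n * green f y = green f x0 by rewrite -green_orb // yx.
  have : 0 < green f y by move: Gx0; rewrite -Gy pmulr_rgt0.
  move/lt_le_trans; apply; apply: xmax; split => //=.
  by rewrite -(ler_pM2l (dX n)) Gy -ler_pdivrMr.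
have {}Gxw : green f x < green f w0.
  rewrite lt_neqAle Gxw andbT; apply/eqP => E; apply: nAw.
  by apply: (level_saturated Ax) => //.
pose s := green f w0 - green f x; have s0 : 0 < s by rewrite subr_gt0.
have [n1 Hn1] := expr_unbounded (green f Q.[(r0%:C)%C * e] / green f x) d1.
have [n2 Hn2] := expr_unbounded (B / s) d1.
pose n := maxn n1 n2.
have hn1 : green f Q.[(r0%:C)%C * e] <= d ^+ n * green f x.
  rewrite -ler_pdivrMr //; apply: le_trans Hn1 _.
  by rewrite ler_eXn2l // leq_maxl.
have hn2 : B <= d ^+ n * s.
  rewrite -ler_pdivrMr //; apply: le_trans Hn2 _.
  by rewrite ler_eXn2l // leq_maxr.
have [r rr0 Gr] := green_ray_surj Q1 e1 hn1.
have AQr : A Q.[(r%:C)%C * e].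
  apply: (level_saturated (x := orb f n x)).
  - exact: (invariant_orb Af n x).1.
  - by rewrite green_orb // mulr_gt0.
  - by rewrite Gr green_orb.
have APr : A P.[(r%:C)%C * e] by apply: (AP _).1; exact: (AQ _).2.
have [y yP [_ /(_ APr) Ay]] := surj n P.[(r%:C)%C * e].
have Gy : d ^+ n * green f y = green f P.[(r%:C)%C * e] by rewrite -green_orb // yP.
have [h1 h2] := HB r rr0; rewrite -Gy Gr in h1 h2.
have : green f y <= green f x.
  apply: xmax; split => //=; rewrite -(ler_pM2l (dX n)); apply: le_trans h2 _.
  by rewrite -lerBrDl -mulrBr.
by rewrite leNgt -(ltr_pM2l (dX n)) h1.
Qed.

End AllOrNothing.

(** * Polynomials that commute up to an isometry *)

Section Commuting.
Context {R : realType}.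
Implicit Types (p q f g : {poly R[i]}) (z w u c : R[i]).

Lemma poly_ext p q : (forall w, p.[w] = q.[w]) -> p = q.
Proof.
move=> pq; apply/subr0_eq.
have H w : (p - q).[w] = 0 by rewrite hornerD hornerN pq subrr.
have [h|h] := leqP (size (p - q)) 1.
  by rewrite (size1_polyC h) -(hornerC (p - q)`_0 0) -(size1_polyC h) H.
have [z] := poly_surj 1 h; rewrite H => /eqP.
by rewrite eq_sym oner_eq0.
Qed.

Lemma derivn_comp_affine p u c n :
  (p \Po (u *: 'X + c%:P))^`(n) = u ^+ n *: (p^`(n) \Po (u *: 'X + c%:P)).
Proof.
elim: n => [|n IH]; first by rewrite !derivn0 expr0 scale1r.
rewrite !derivnS IH derivZ deriv_comp derivD derivC addr0 derivZ derivX.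
by rewrite -scalerAr mulr1 scalerA exprSr.
Qed.

(** The derivative of order [deg f - 1] of [f] is a polynomial of degree one; its
    root is fixed by [w |-> u * w + c]. *)
Lemma affine_symmetry_bounded f : (2 <= deg f)%N -> exists B : R,
  forall u c l k, nc u = 1 -> (forall w, f.[u * w + c] = l * f.[w] + k) -> nc c <= B.
Proof.
move=> f2; pose n := (deg f).-1; pose p := f^`(n).
have n0 : (0 < n)%N by rewrite /n -subn1 subn_gt0.
have nE : (n.+1 = deg f)%N by rewrite /n prednK // (ltn_trans _ f2).
have p1 : p`_1 != 0.
  rewrite coef_derivn addn1 nE -/(lead_coef f) mulrn_eq0 lead_coef_eq0.
  by rewrite (negPf (deg_neq0 f2)) orbF -lt0n ffact_gt0 /n leq_pred.
have sp : (size p <= 2)%N.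
  apply/leq_sizeP => j j2; rewrite coef_derivn nth_default ?mul0rn //.
  have : (size f <= (deg f).+1)%N by rewrite /deg leqSpred.
  by move=> /leq_trans; apply; rewrite -nE -addn2 leq_add2l.
have pE w : p.[w] = p`_0 + p`_1 * w.
  by rewrite (horner_coef_wide _ sp) !big_ord_recl big_ord0 /= expr0 mulr1 expr1 addr0.
pose w0 := - p`_0 / p`_1.
have pw0 : p.[w0] = 0 by rewrite pE /w0 mulrC divfK // subrr.
exists (2 * nc w0) => u c l k u1 H.
have E : f \Po (u *: 'X + c%:P) = l *: f + k%:P.
  by apply: poly_ext => w; rewrite horner_comp !(hornerD, hornerZ, hornerX, hornerC) H.
have := congr1 (fun q : {poly R[i]} => q^`(n).[w0]) E.
rewrite /= derivn_comp_affine derivnD derivnZ derivnC gtn_eqF // addr0.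
rewrite !hornerZ -/p pw0 mulr0 horner_comp !(hornerD, hornerZ, hornerX, hornerC) => /eqP.
rewrite mulf_eq0 expf_eq0 -[u == 0]nc_eq0 u1 oner_eq0 andbF /= pE => /eqP h.
have : p`_1 * (u * w0 + c - w0) = 0 by move: h pw0; rewrite pE => h h'; rewrite mulrBr -[X in X - _](addKr p`_0) h -[X in _ - X](addKr p`_0) h' subrr.
move/eqP; rewrite mulf_eq0 (negPf p1) /= => /eqP h'.
have -> : c = w0 - u * w0 by rewrite -[X in X - _](subr0_eq h') addrAC subrr add0r.
apply: le_trans (nc_triangle _ _) _; rewrite ncN ncM u1; lra.
Qed.

Variables f g : {poly R[i]}.
Hypotheses (f2 : (2 <= deg f)%N) (g2 : (2 <= deg g)%N).

(** The isometries are bounded by [affine_symmetry_bounded]: with [v], [b] and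
    [t], [a] those of the iterates [n.+1] and [1], the isometry of the iterate
    [n] satisfies [f.[u * w + c] = v / t * (f.[w] - a) + b]. Therefore [g] maps
    points with a bounded [f]-orbit to points with a bounded [f]-orbit. *)
Lemma filled_of_commuting :
  (forall n, exists u c, nc u = 1 /\
     iter_poly f n \Po g = u *: (g \Po iter_poly f n) + c%:P) ->
  forall z, green f z = 0 -> green g z = 0.
Proof.
move=> H.
have H' n : exists u c, nc u = 1 /\ forall z, orb f n g.[z] = u * g.[orb f n z] + c.
  have [u [c [u1 E]]] := H n; exists u, c; split => // z.
  have := congr1 (fun q : {poly R[i]} => q.[z]) E.
  by rewrite hornerD hornerZ hornerC !horner_comp !horner_iter_poly.
have [B HB] := affine_symmetry_bounded f2.
have Hc n : exists u c, [/\ nc u = 1, nc c <= B & forall z, orb f n g.[z] = u * g.[orb f n z] + c].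
  have [u [c [u1 E]]] := H' n; exists u, c; split => //.
  have [v [b [v1 Ev]]] := H' n.+1; have [t [a [t1 Et]]] := H' 1%N.
  have t0 : t != 0 by rewrite -nc_gt0 t1.
  apply: (HB u c (v / t) (b - v / t * a) u1) => w.
  have [y yw] := poly_surj w (deg_size g2).
  have [|z zy] := @poly_surj R (iter_poly f n) y.
    by rewrite -subn_gt0 subn1 size_iter_poly ?deg_size // expn_gt0 (ltn_trans _ f2).
  rewrite horner_iter_poly in zy.
  have := E z; rewrite zy yw => <-; rewrite -orbS Ev orbS zy.
  have := Et y; rewrite /= yw => ->; field.
  by [].
have step z : green f z = 0 -> green f g.[z] = 0.
  move=> /(filled_juliaP f2)[M HM]; apply/(filled_juliaP f2).
  have [D D0 HD] := poly_bounded g M.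
  exists (D + B) => n; have [u [c [u1 cB ->]]] := Hc n.
  by rewrite (le_trans (nc_triangle _ _)) // ncM u1 mul1r lerD // HD.
move=> z Gz; apply/(filled_juliaP g2).
have [M HM] := filled_julia_bounded f2; exists M => n; apply/HM/(filled_juliaP f2).
by elim: n => [|n IH] //; rewrite orbS step.
Qed.

Lemma commuting_dichotomy :
  (forall z, green f z = 0 -> green g z = 0) \/
  exists (P Q : {poly R[i]}) e, [/\ size P = size Q, (1 < size P)%N, dominates_on_ray P Q e,
     (forall A : set R[i], (forall z, A z <-> A f.[z]) -> (forall z, A z <-> A g.[z]) ->
        forall z, A z <-> A P.[z]) &
     (forall A : set R[i], (forall z, A z <-> A f.[z]) -> (forall z, A z <-> A g.[z]) ->
        forall z, A z <-> A Q.[z])].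
Proof.
have [|/existsNP[n Hn]] := pselect (forall n, exists u c, nc u = 1 /\
     iter_poly f n \Po g = u *: (g \Po iter_poly f n) + c%:P).
  by left; exact: filled_of_commuting.
right.
have dn : (0 < (size (iter_poly f n)).-1)%N.
  by rewrite size_iter_poly ?deg_size // expn_gt0 (ltn_trans _ f2).
have dg : (0 < (size g).-1)%N by rewrite -/(deg g) (ltn_trans _ g2).
have d1 := size_comp_poly (iter_poly f n) g.
have d2 := size_comp_poly g (iter_poly f n).
have s1 : (1 < size (iter_poly f n \Po g))%N.
  by rewrite -subn_gt0 subn1 d1 muln_gt0 dn.
have s2 : (1 < size (g \Po iter_poly f n))%N.
  by rewrite -subn_gt0 subn1 d2 muln_gt0 dg.
have s12 : size (iter_poly f n \Po g) = size (g \Po iter_poly f n).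
  by rewrite -[LHS]prednK ?(ltn_trans _ s1) // -[RHS]prednK ?(ltn_trans _ s2) // d1 d2 mulnC.
have AP (A : set R[i]) : (forall z, A z <-> A f.[z]) -> (forall z, A z <-> A g.[z]) ->
        forall z, A z <-> A (iter_poly f n \Po g).[z].
  move=> Af Ag z; rewrite horner_comp horner_iter_poly; have := invariant_orb Af n g.[z].
  by have := Ag z; tauto.
have AQ (A : set R[i]) : (forall z, A z <-> A f.[z]) -> (forall z, A z <-> A g.[z]) ->
        forall z, A z <-> A (g \Po iter_poly f n).[z].
  move=> Af Ag z; rewrite horner_comp horner_iter_poly; have := invariant_orb Af n z.
  by have := Ag (orb f n z); tauto.
have [//|[e [r|r]]] := ray_dichotomy s12 s1.
- by exists (iter_poly f n \Po g), (g \Po iter_poly f n), e; split.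
- by exists (g \Po iter_poly f n), (iter_poly f n \Po g), e; split.
Qed.

End Commuting.

(** * Equality of the filled Julia sets *)

Section Core.
Context {R : realType}.
Implicit Types (f g : {poly R[i]}) (z w : R[i]) (A : set R[i]).

(** The [g]-orbit of a point of the basin of [g] enters the basin of [f]. *)
Lemma basin_transfer f g A : (2 <= deg f)%N -> (2 <= deg g)%N ->
  (forall z, A z <-> A g.[z]) ->
  (forall w, 0 < green f w -> A w) -> forall w, 0 < green g w -> A w.
Proof.
move=> f2 g2 Ag H w Gw; have [M HM] := filled_julia_bounded f2.
have [N /(_ N (leqnn N)) HN] := orb_large g2 M Gw.
apply: (invariant_orb Ag N w).2; apply: H.
rewrite lt_neqAle green_ge0 // andbT eq_sym; apply/eqP => /(filled_juliaP f2)/HM.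
by rewrite leNgt HN.
Qed.

(** The complement of [A] accumulates at each boundary point of [K_f] by
    [boundary_hits], hence such a point is not in the open basin of [g]. *)
Lemma filled_le_of_basins f g A x1 x2 : (2 <= deg f)%N -> (2 <= deg g)%N ->
  (forall z, A z <-> A f.[z]) ->
  (forall w, 0 < green g w -> A w) -> ~ A x1 -> ~ A x2 -> x1 != x2 ->
  forall z, green f z = 0 -> green g z = 0.
Proof.
move=> f2 g2 Af Hg A1 A2 x12; apply: filled_le => // z Gz nlm.
apply/eqP; rewrite eq_le green_ge0 // andbT leNgt; apply/negP => Gg.
have [e e0 He] := green_continuous g2 z Gg.
have nAf w : (~` A) w <-> (~` A) f.[w] by have := Af w; rewrite /setC /=; tauto.
have [v vz] := boundary_hits f2 nAf A1 A2 x12 Gz nlm e0.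
by apply; apply: Hg; have := He v vz; rewrite ltr_norml => /andP[]; lra.
Qed.

(** [commuting_dichotomy] is applied in both orders. As soon as one of them gives a
    ray, both inclusions follow from [filled_le_of_basins], with [A] or with its
    complement; otherwise each order gives one inclusion. *)
Theorem filled_julia_eq f g A x1 x2 y1 y2 : (2 <= deg f)%N -> (2 <= deg g)%N ->
  (forall z, A z <-> A f.[z]) -> (forall z, A z <-> A g.[z]) -> nc_closed A ->
  A x1 -> A x2 -> x1 != x2 -> ~ A y1 -> ~ A y2 -> y1 != y2 ->
  forall z, green f z = 0 <-> green g z = 0.
Proof.
move=> f2 g2 Af Ag Acl Ax1 Ax2 x12 Ay1 Ay2 y12.
have aux f' g' : (2 <= deg f')%N -> (2 <= deg g')%N ->
    (forall z, A z <-> A f'.[z]) -> (forall z, A z <-> A g'.[z]) ->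
    (forall z, green f' z = 0 -> green g' z = 0) \/
    (forall z, green f' z = 0 <-> green g' z = 0).
  move=> f2' g2' Af' Ag'.
  have [|[P [Q [e [PQ P1 ray AP AQ]]]]] := commuting_dichotomy f2' g2'; first by left.
  right; have [ex|nex] := pselect (exists2 x, A x & 0 < green f' x).
    have Hf := all_or_nothing f2' Af' Acl PQ P1 ray (AP A Af' Ag') (AQ A Af' Ag') ex.
    have Hg := basin_transfer f2' g2' Ag' Hf.
    by move=> z; split; apply: filled_le_of_basins Ay1 Ay2 y12 z.
  have nAf w : (~` A) w <-> (~` A) f'.[w] by have := Af' w; rewrite /setC /=; tauto.
  have nAg w : (~` A) w <-> (~` A) g'.[w] by have := Ag' w; rewrite /setC /=; tauto.
  have Hf w : 0 < green f' w -> (~` A) w by move=> Gw Aw; apply: nex; exists w.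
  have Hg := basin_transfer f2' g2' nAg Hf.
  have n1 : ~ (~` A) x1 by apply.
  have n2 : ~ (~` A) x2 by apply.
  by move=> z; split; apply: filled_le_of_basins n1 n2 x12 z.
have [fg|//] := aux f g f2 g2 Af Ag.
have [gf|gf] := aux g f g2 f2 Ag Af; move=> z; last by rewrite gf.
by split; [exact: fg|exact: gf].
Qed.

End Core.

(** * The topology of the sphere *)

Section Sphere.
Context {R : realType}.
Local Notation S := (riemann_sphere R).
Implicit Types (z w : R[i]) (p q : S).

Lemma half_chord_bounds p q : 0 <= half_chord p q <= 1.
Proof.
have s1 z : 1 <= Num.sqrt (1 + nc z ^+ 2).
  by rewrite -[leLHS]sqrtr1 ler_wsqrtr // lerDl sqr_ge0.
case: p q => [z|] [w|]; rewrite /half_chord ?lexx ?ler01 //; last 2 first.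
- have := s1 z => h; rewrite invr_ge0 invf_le1 ?h ?andbT; lra.
- have := s1 w => h; rewrite invr_ge0 invf_le1 ?h ?andbT; lra.
have hz := s1 z; have hw := s1 w.
have p0 : 0 < Num.sqrt (1 + nc z ^+ 2) * Num.sqrt (1 + nc w ^+ 2) by rewrite mulr_gt0; lra.
rewrite divr_ge0 ?nc_ge0 ?(ltW p0) //= ler_pdivrMr // mul1r.
apply: le_trans (nc_triangle _ _) _; rewrite ncN.
rewrite -(@ler_pXn2r _ 2) ?nnegrE ?addr_ge0 ?nc_ge0 ?(ltW p0) //.
rewrite exprMn !sqr_sqrtr ?addr_ge0 ?sqr_ge0 //.
have := sqr_ge0 (1 - nc z * nc w); nra.
Qed.

Lemma asin_at0 : asin (0 : R) = 0.
Proof.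
rewrite -[in LHS](@sin0 R) sinK // in_itv /=.
by have := pi_gt0 R; lra.
Qed.

Lemma dist_of_chord (e : R) : 0 < e -> exists2 d : R, 0 < d &
  forall p q, half_chord p q < d -> mdist p q < e.
Proof.
move=> e0; have := @continuous_asin R 0; rewrite oppr_lt0 ltr01 => /(_ isT).
move=> /cvgrPdist_lt /(_ (e / 2)); rewrite divr_gt0 // => /(_ isT) /nbhs_ballP[d /= d0 Hd].
exists d => // p q pq; have /andP[h0 h1] := half_chord_bounds p q.
have := Hd (half_chord p q); rewrite -ball_normE /= sub0r normrN ger0_norm // => /(_ pq).
rewrite asin_at0 sub0r normrN => h.
change (2 * asin (half_chord p q) < e).
by have := ler_norm (asin (half_chord p q)); lra.
Qed.

(** With [dist_of_chord], this allows the chord to replace the great-circle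
    distance in all questions of convergence. *)
Lemma chord_of_dist (e : R) : 0 < e -> exists2 d : R, 0 < d &
  forall p q, mdist p q < d -> half_chord p q < e.
Proof.
move=> e0; have := @continuous_sin R 0.
move=> /cvgrPdist_lt /(_ e e0) /nbhs_ballP[d /= d0 Hd].
exists (2 * d) => [|p q pq]; first by rewrite mulr_gt0.
have /andP[h0 h1] := half_chord_bounds p q.
have m0 := mdist_ge0 p q.
have E : mdist p q = 2 * asin (half_chord p q) by [].
rewrite E in pq m0.
have := Hd (asin (half_chord p q)); rewrite -ball_normE /= sub0r normrN ger0_norm; last lra.
rewrite sin0 sub0r normrN asinK; last by rewrite in_itv /= h1 andbT; lra.
by rewrite ger0_norm // => h; apply: h; lra.
Qed.

Lemma half_chord_Some z w : half_chord (Some z : S) (Some w) <= nc (z - w).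
Proof.
rewrite /half_chord ler_pdivrMr; last first.
  by rewrite mulr_gt0 // sqrtr_gt0 ltr_wpDr ?sqr_ge0.
rewrite ler_peMr ?nc_ge0 // mulr_ege1 // -[leLHS]sqrtr1 ler_wsqrtr // lerDl sqr_ge0 //.
Qed.

Lemma sqrt_1D (x : R) : 0 <= x -> x <= Num.sqrt (1 + x ^+ 2) <= 1 + x.
Proof.
move=> x0; apply/andP; split.
  by rewrite -[leLHS]ger0_norm // -sqrtr_sqr ler_wsqrtr // lerDr.
rewrite -[leRHS]ger0_norm ?addr_ge0 // -sqrtr_sqr ler_wsqrtr //; nra.
Qed.

Lemma nbhs_Some z (V : set S) : nbhs (Some z : S) V ->
  exists2 r : R, 0 < r & forall w, nc (w - z) < r -> V (Some w).
Proof.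
move=> /nbhs_ballP[e /= e0 He]; have [d d0 Hd] := dist_of_chord e0.
exists d => // w wz; apply: He; rewrite ballEmdist /=; apply: Hd.
by apply: le_lt_trans (half_chord_Some _ _) _; rewrite nc_distC.
Qed.

Lemma Some_nbhs z (V : set S) (r : R) : 0 < r ->
  (forall w, nc (w - z) < r -> V (Some w)) -> nbhs (Some z : S) V.
Proof.
move=> r0 HV; pose N := 1 + nc z; have N1 : 1 <= N by rewrite lerDl nc_ge0.
have N0 : 0 < N by lra.
(* A chord below [1 / (2 * N)] excludes infinity and gives
   [nc (z - w) <= 2 * e * N ^+ 2]. *)
pose e := Num.min (1 / (2 * N)) (r / (4 * N ^+ 2)).
have e0 : 0 < e by rewrite lt_min !divr_gt0 ?mulr_gt0 ?exprn_gt0.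
have e1 : e * N <= 1 / 2.
  have : e <= 1 / (2 * N) by rewrite /e ge_min lexx.
  by rewrite ler_pdivlMr ?mulr_gt0 //; lra.
have e2 : e * (4 * N ^+ 2) <= r.
  have : e <= r / (4 * N ^+ 2) by rewrite /e ge_min lexx orbT.
  by rewrite ler_pdivlMr ?mulr_gt0 ?exprn_gt0.
have [d d0 Hd] := chord_of_dist e0.
apply/nbhs_ballP; exists d => // q; rewrite ballEmdist /= => /Hd.
have /andP[_ zN] := sqrt_1D (nc_ge0 z).
have sp w : 0 < Num.sqrt (1 + nc w ^+ 2) by rewrite sqrtr_gt0 ltr_wpDr ?sqr_ge0.
case: q => [w|]; rewrite /half_chord; last first.
  rewrite invf_plt ?posrE // => h; exfalso.
  have : 2 * N <= e^-1 by rewrite -[leLHS]invrK lef_pV2 ?posrE ?invr_gt0 ?mulr_gt0 // -div1r /e ge_min lexx.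
  rewrite -/N in zN; lra.
rewrite ltr_pdivrMr ?mulr_gt0 // => h; apply: HV.
have /andP[_ wN] := sqrt_1D (nc_ge0 w).
have wz : nc w <= nc z + nc (z - w) by have := ncB w z; rewrite nc_distC; lra.
have {}h : nc (z - w) < e * (N * (N + nc (z - w))).
  apply: lt_le_trans h _; rewrite ler_pM2l //.
  by apply: ler_pM; rewrite ?(ltW (sp _)) // /N; lra.
rewrite nc_distC; set a := nc (z - w) in h *.
have a0 : 0 <= a by exact: nc_ge0.
have := ler_wpM2r a0 e1; rewrite expr2 in e2; lra.
Qed.

Lemma nbhs_None (V : set S) : nbhs (None : S) V ->
  exists Q : R, forall w, Q < nc w -> V (Some w).
Proof.
move=> /nbhs_ballP[e /= e0 He]; have [d d0 Hd] := dist_of_chord e0.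
exists d^-1 => w wQ; apply: He; rewrite ballEmdist /=; apply: Hd.
have /andP[h _] := sqrt_1D (nc_ge0 w).
have i0 : 0 < d^-1 by rewrite invr_gt0.
by rewrite /half_chord invf_plt ?posrE //; lra.
Qed.

Lemma None_nbhs (V : set S) (Q : R) : V None ->
  (forall w, Q < nc w -> V (Some w)) -> nbhs (None : S) V.
Proof.
move=> VN HV; pose e := (2 + `|Q|)^-1.
have Q0 : 0 < 2 + `|Q| by rewrite ltr_wpDr.
have e0 : 0 < e by rewrite invr_gt0.
have [d d0 Hd] := chord_of_dist e0.
apply/nbhs_ballP; exists d => // q; rewrite ballEmdist /= => /Hd.
case: q => [w|//]; rewrite /half_chord ltf_pV2 ?posrE //; last first.
  by rewrite sqrtr_gt0 ltr_wpDr ?sqr_ge0.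
have /andP[_ h] := sqrt_1D (nc_ge0 w) => h'; apply: HV.
by have := ler_norm Q; lra.
Qed.

Lemma mdist_Some_bound (M : R) : exists2 e : R, 0 < e & exists Q : R,
  forall z w, nc z <= M -> Q < nc w -> e <= mdist (Some z : S) (Some w).
Proof.
pose m := 1 + `|M|; have m0 : 0 < m by rewrite ltr_pwDl.
have e0 : 0 < (4 * m)^-1 by rewrite invr_gt0 mulr_gt0.
have [d d0 Hd] := chord_of_dist e0; exists d => //.
exists (2 * m) => z w zM wQ; rewrite leNgt; apply/negP => /Hd; apply/negP.
rewrite -leNgt /half_chord.
have sp (v : R[i]) : 0 < Num.sqrt (1 + nc v ^+ 2) by rewrite sqrtr_gt0 ltr_wpDr ?sqr_ge0.
have /andP[_ h1] := sqrt_1D (nc_ge0 z); have /andP[_ h2] := sqrt_1D (nc_ge0 w).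
have zm : 1 + nc z <= m by rewrite lerD2l (le_trans zM) // ler_norm.
rewrite ler_pdivlMr ?mulr_gt0 //.
have m1 : 1 <= m by rewrite lerDl.
apply: (@le_trans _ _ ((4 * m)^-1 * (m * (2 * nc w)))).
  rewrite ler_pM2l //; apply: ler_pM; rewrite ?(ltW (sp _)) //; lra.
have -> : (4 * m)^-1 * (m * (2 * nc w)) = nc w / 2 by field; rewrite gt_eqF.
have := ncB w z; rewrite nc_distC; have := nc_ge0 z; lra.
Qed.

Lemma uniform_cvgP (V : set S) (u : nat -> S -> S) (l : S -> S) :
  {uniform V, u @ \oo --> l} <->
  forall e : R, 0 < e -> exists N, forall n, (N <= n)%N -> forall y, V y -> mdist (l y) (u n y) < e.
Proof.
split=> [cv e e0|H P /uniform_nbhs[E [entE EP]]].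
  have : nbhs (l : {uniform` V -> S}) [set h | forall y, V y -> ball (l y) e (h y)].
    apply/uniform_nbhs; exists [set xy | ball xy.1 e xy.2]; split => //.
    by rewrite -entourage_ballE; exists e.
  move=> /cv [N _ HN]; exists N => n Nn y Vy.
  by have := HN n Nn y Vy; rewrite ballEmdist.
move: entE; rewrite -entourage_ballE => -[e /= e0 He].
have [N HN] := H e e0; exists N => // n /= Nn; apply: EP => y Vy.
by apply: He; rewrite /= ballEmdist /=; exact: HN.
Qed.

End Sphere.

(** * Subsequences *)

Section Subsequences.

(** The diagonal construction of a subsequence from properties that hold
    frequently. *)
Lemma subsequence_of_frequently (P : nat -> nat -> Prop) :
  (forall j N, exists2 n, (N <= n)%N & P j n) ->
  exists2 k : nat -> nat, {homo k : m n / (m < n)%N} & forall j, P j (k j).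
Proof.
move=> H.
have /choice[F HF] : forall jN : nat * nat, exists n, (jN.2 <= n)%N /\ P jN.1 n.
  by move=> [j N]; have [n] := H j N; exists n.
pose fix k j := if j is j'.+1 then F (j, (k j').+1) else F (0%N, 0%N).
exists k; last by case=> [|j]; [exact: (HF (0%N, 0%N)).2|exact: (HF (j.+1, (k j).+1)).2].
by apply: homo_ltn; [exact: ltn_trans|move=> j; exact: (HF (j.+1, (k j).+1)).1].
Qed.

(** Iterates along a sequence [k] of exponents subconverge for different reasons
    according to whether [k] is bounded. *)
Lemma subsequence_dichotomy (k : nat -> nat) :
  (exists2 s : nat -> nat, {homo s : m n / (m < n)%N} & forall j, (j <= k (s j))%N) \/
  exists v, exists2 s : nat -> nat, {homo s : m n / (m < n)%N} & forall j, k (s j) = v.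
Proof.
have [H|/existsNP[j0 /existsNP[N0 H]]] :=
  pselect (forall j N, exists2 n, (N <= n)%N & (j <= k n)%N).
  by left; exact: subsequence_of_frequently H.
right.
have {H} : forall n, (N0 <= n)%N -> (k n < j0)%N.
  by move=> n Nn; rewrite ltnNge; apply/negP => h; apply: H; exists n.
elim: j0 N0 => [N0 /(_ N0 (leqnn _))//|j IH] N0 H.
have [H'|/existsNP[N H']] := pselect (forall N, exists2 n, (N <= n)%N & k n = j).
  by exists j; apply: (@subsequence_of_frequently (fun _ n => k n = j)).
apply: (IH (maxn N0 N)) => n; rewrite geq_max => /andP[n1 n2].
have := H n n1; rewrite ltnS leq_eqVlt => /orP[/eqP kn|//].
by exfalso; apply: H'; exists n.
Qed.

End Subsequences.

(** * Normality of bounded sequences *)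

Section Montel.
Context {R : realType}.
Implicit Types (v w : R[i]).
Import ArrowAsProduct.

Lemma finite_net (z : R[i]) (r : R) m : 0 < r -> exists s : seq R[i],
  (forall v, v \in s -> nc (v - z) <= 2 * r) /\
  forall w, nc (w - z) <= r -> exists2 v, v \in s & nc (w - v) <= 2 * r / m.+1%:R.
Proof.
move=> r0; pose x (a : nat) : R := r * (a%:R / m.+1%:R - 1).
have m0 : 0 < m.+1%:R :> R by rewrite ltr0n.
exists [seq z + (x a +i* x b)%C | a <- iota 0 (2 * m.+1).+1, b <- iota 0 (2 * m.+1).+1].
have xb a : a \in iota 0 (2 * m.+1).+1 -> `|x a| <= r.
  rewrite mem_iota add0n /= ltnS => am.
  rewrite /x normrM gtr0_norm // ger_pMr // ler_norml.
  have h0 : 0 <= a%:R / m.+1%:R :> R by rewrite divr_ge0.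
  have h2 : a%:R / m.+1%:R <= 2 :> R by rewrite ler_pdivrMr // -natrM ler_nat.
  by move: (_ / _) h0 h2 => y h0 h2; apply/andP; split; lra.
split=> [_ /allpairsP[[a b] /= [ha hb ->]]|w wz].
  rewrite addrC addKr (le_trans (nc_le_ReIm _)) //=.
  by have := xb a ha; have := xb b hb; lra.
have near (t : R) : `|t| <= r -> exists2 a, a \in iota 0 (2 * m.+1).+1 & `|t - x a| <= r / m.+1%:R.
  rewrite ler_norml => /andP[t1 t2]; pose y := (t / r + 1) * m.+1%:R.
  have tr1 : - 1 <= t / r by rewrite ler_pdivlMr //; lra.
  have tr2 : t / r <= 1 by rewrite ler_pdivrMr //; lra.
  have y0 : 0 <= y by rewrite mulr_ge0 //; lra.
  have /andP[h1 h2] := truncn_itv y0; exists (Num.truncn y).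
    rewrite mem_iota add0n /= ltnS -(ler_nat R); apply: le_trans h1 _.
    by rewrite natrM ler_pM2r //; lra.
  have -> : t - x (Num.truncn y) = r / m.+1%:R * (y - (Num.truncn y)%:R).
    by rewrite /x /y; field; rewrite !gt_eqF.
  rewrite normrM gtr0_norm ?divr_gt0 // ger_pMr ?divr_gt0 // ler_norml.
  by rewrite -natr1 in h2; lra.
have [a ha xa] := near (complex.Re (w - z)) (le_trans (Re_le_nc _) wz).
have [b hb yb] := near (complex.Im (w - z)) (le_trans (Im_le_nc _) wz).
exists (z + (x a +i* x b)%C); first by apply/allpairsP; exists (a, b).
rewrite opprD addrA (le_trans (nc_le_ReIm _)) //.
have -> : 2 * r / m.+1%:R = r / m.+1%:R + r / m.+1%:R by rewrite -mulrA mulr_natl mulr2n.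
by move: xa yb; case: (w - z) => c d /=; exact: lerD.
Qed.

(** A limit point of the sequence for pointwise convergence exists by Tychonoff's
    theorem. Matching it on finer and finer finite nets of the disc gives
    a subsequence, which converges uniformly because all functions have the same
    Lipschitz constant. *)
Lemma montel_extraction (u : nat -> R[i] -> R[i]) (z : R[i]) (r M L : R) : 0 < r -> 0 <= L ->
  (forall n w, nc (w - z) <= 2 * r -> nc (u n w) <= M) ->
  (forall n v w, nc (v - z) <= 2 * r -> nc (w - z) <= 2 * r ->
     nc (u n v - u n w) <= L * nc (v - w)) ->
  exists2 k : nat -> nat, {homo k : m n / (m < n)%N} &
  exists l : R[i] -> R[i], forall e : R, 0 < e -> exists N, forall n, (N <= n)%N ->
    forall w, nc (w - z) <= r -> nc (u (k n) w - l w) < e.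
Proof.
move=> r0 L0 uM uL.
pose T (_ : R[i]) : topologicalType := (R * R)%type.
(* The values outside the disc are cut off so that all functions belong to the
   same product of compact squares. *)
pose phi n : forall w : R[i], T w := fun w => if nc (w - z) <= 2 * r
   then (complex.Re (u n w), complex.Im (u n w)) else (0, 0).
pose K (w : R[i]) : set (T w) := (`[- `|M|, `|M|] `*` `[- `|M|, `|M|])%classic.
have cK w : compact (K w) by apply: compact_setX; exact: segment_compact.
have phiK n w : K w (phi n w).
  rewrite /K /phi; case: ifP => [h|_] /=; rewrite !in_itv /=.
    have hM : nc (u n w) <= `|M| by rewrite (le_trans (uM n w h)) // ler_norm.
    rewrite -!ler_norml; split; apply: le_trans hM; [exact: Re_le_nc|exact: Im_le_nc].
  by rewrite oppr_le0 normr_ge0.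
have [|p [Kp clp]] := @tychonoff _ T K cK (phi @ \oo) _.
  by exists 0%N => // n _ w; exact: phiK.
pose l w := ((p w).1 +i* (p w).2)%C.
have approx (s : seq R[i]) (e : R) N : 0 < e -> exists2 n, (N <= n)%N &
    forall w, w \in s -> nc (w - z) <= 2 * r -> nc (u n w - l w) < e.
  move=> e0; have e2 : 0 < e / 2 by rewrite divr_gt0.
  have nB : nbhs p [set g : forall w, T w | forall w, w \in s -> ball (p w : R * R) (e / 2) (g w)].
    elim: s => [|v s IH]; first by apply: filterS filterT.
    have nv : nbhs p [set g : forall w, T w | ball (p v : R * R) (e / 2) (g v)].
      exact: (@proj_continuous _ T v p _ (nbhsx_ballx (p v : R * R) _ e2)).
    apply: filterS (filterI nv IH).
    by move=> g [gv gs] w; rewrite inE => /orP[/eqP ->|/gs].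
  have nA : (phi @ \oo) [set phi n | n in [set n | (N <= n)%N]].
    by exists N => // n /= Nn; exists n.
  have [_ [[n /= Nn <-] Hn]] := clp _ _ nA nB.
  exists n => // w ws wz; have := Hn w ws; rewrite /phi wz /l.
  by case: (u n w) => a b; case: (p w) => c d /= /nc_ball_prod.
have lL v w : nc (v - z) <= 2 * r -> nc (w - z) <= 2 * r -> nc (l v - l w) <= L * nc (v - w).
  move=> vz wz; apply/ler_addgt0Pr => e e0.
  have [n _ Hn] := approx [:: v; w] (e / 2) 0%N ltac:(by rewrite divr_gt0).
  have h1 := Hn v ltac:(by rewrite inE eqxx) vz.
  have h2 := Hn w ltac:(by rewrite !inE eqxx orbT) wz.
  have h3 := uL n v w vz wz; rewrite nc_distC in h1.
  have := nc_dist_triangle (u n v) (l v) (l w); have := nc_dist_triangle (u n w) (u n v) (l w); lra.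
have /choice[net Hnet] := fun m => finite_net z m r0.
have [k hk Hk] := @subsequence_of_frequently (fun j n => forall w, w \in net j -> nc (w - z) <= 2 * r ->
    nc (u n w - l w) < j.+1%:R^-1) (fun j N => approx (net j) j.+1%:R^-1 N ltac:(by [])).
exists k => //; exists l => e e0.
exists (Num.bound ((4 * L * r + 1) / e)) => n Nn w wz.
have c0 : 0 <= 4 * L * r + 1 by rewrite addr_ge0 // !mulr_ge0 // ltW.
have n0 : 0 < n.+1%:R :> R by rewrite ltr0n.
have main : (4 * L * r + 1) / n.+1%:R < e.
  rewrite ltr_pdivrMr // (mulrC e) -ltr_pdivrMr //.
  apply: lt_le_trans (archi_boundP (divr_ge0 c0 (ltW e0))) _.
  by rewrite ler_nat (leq_trans Nn).
have [net1 /(_ w wz) [v vs vw]] := Hnet n.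
have vz := net1 v vs; have wz2 : nc (w - z) <= 2 * r by lra.
have h1 := uL (k n) w v wz2 vz; have h2 := Hk n v vs vz; have h3 := lL v w vz wz2.
rewrite (nc_distC v w) in h3.
have h4 := ler_wpM2l L0 vw.
have := nc_dist_triangle (u (k n) v) (u (k n) w) (l w); have := nc_dist_triangle (l v) (u (k n) v) (l w).
move: main h4; rewrite -[2 * r / _]/(2 * r * _) mulrDl mul1r; set i := n.+1%:R^-1 in h2 *; lra.
Qed.

(** The divided difference of [p] at [w] is a polynomial, which can be estimated
    on the circle of radius [2 * r] by the maximum modulus principle. *)
Lemma bounded_poly_lipschitz (p : {poly R[i]}) (z v w : R[i]) (r M : R) : 0 < r ->
  (forall y, nc (y - z) <= 2 * r -> nc p.[y] <= M) ->
  nc (v - z) <= r -> nc (w - z) <= r -> nc (p.[v] - p.[w]) <= 2 * M / r * nc (v - w).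
Proof.
move=> r0 pM vz wz; have [s [ps _]] := divided_difference p w.
rewrite ps ncM mulrC ler_wpM2r ?nc_ge0 //.
apply: (@max_modulus R s z (2 * r)); [by rewrite mulr_ge0 // ltW| |lra].
move=> y yz; rewrite ler_pdivlMr //.
have yw : r <= nc (y - w) by have := nc_dist_triangle w y z; lra.
apply: (@le_trans _ _ (nc s.[y] * nc (y - w))); first by rewrite ler_wpM2l ?nc_ge0.
rewrite mulrC -ncM -ps (le_trans (nc_triangle _ _)) // ncN.
have := pM y ltac:(by rewrite yz); have := pM w ltac:(lra); lra.
Qed.

End Montel.

(** * The Julia set is the boundary of the filled Julia set *)

Section JuliaSet.
Context {R : realType}.
Local Notation S := (riemann_sphere R).
Variable f : {poly R[i]}.
Hypothesis f2 : (2 <= deg f)%N.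
Implicit Types (z w : R[i]) (p : S).
Local Notation d := ((deg f)%:R : R).

Lemma iter_Some n z : iter n (poly_map f) (Some z) = Some (orb f n z).
Proof. by elim: n => //= n ->. Qed.

Lemma iter_None n : iter n (poly_map f) None = None.
Proof. by elim: n => //= n ->; rewrite /= deg_size. Qed.

Lemma iterates_choice (u : nat -> S -> S) :
  (forall n, iterates (poly_map f) (u n)) ->
  exists k, forall n, u n = iter (k n) (poly_map f).
Proof.
move=> H; have /choice[k Hk] : forall n, exists k, u n = iter k (poly_map f).
  by move=> n; have [k _ ->] := H n; exists k.
by exists k.
Qed.

Lemma normal_constant (U : set S) (u : nat -> S -> S) (s : nat -> nat) (h : S -> S) :
  open U -> {homo s : m n / (m < n)%N} -> (forall j, u (s j) = h) ->
  exists2 k : nat -> nat, {homo k : m n / (m < n)%N} &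
  exists l : S -> S, forall x, U x ->
    exists2 V, nbhs x V & {uniform V, (u \o k) @ \oo --> l}.
Proof.
move=> oU hs us; exists s => //; exists h => x Ux; exists U.
  by apply: open_nbhs_nbhs.
apply/uniform_cvgP => e e0; exists 0%N => n _ y _.
by rewrite /= us mdistxx.
Qed.

(** Unbounded exponents give convergence to infinity, uniformly where [green f] is
    bounded below by a positive constant. *)
Lemma fatou_escaping p : (if p is Some z then is_true (0 < green f z) else True) ->
  fatou_set (poly_map f) p.
Proof.
move=> Gp.
have [s s0 sp] : exists2 s : R, 0 < s & if p is Some z then is_true (s < green f z) else True.
  case: p Gp => [z h|_]; last by exists 1.
  by exists (green f z / 2); [rewrite divr_gt0|lra].
pose U := [set q : S | if q is Some w then is_true (s < green f w) else True].
have oU : open U.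
  rewrite openE => -[w|] /= Uq.
    have [e e0 He] := green_continuous f2 w (e := green f w - s) ltac:(by rewrite subr_gt0).
    apply: (Some_nbhs e0) => v /He; rewrite ltr_norml => /andP[h _]; rewrite /U /=; lra.
  have [D D0 HD] := green_bound f2.
  apply: (@None_nbhs _ U (expR (s + D))) => // w wQ; rewrite /U /=.
  have := HD 0%N w; rewrite expr0 mul1r /= /lsize ler_norml => /andP[h _].
  have e0 := expR_gt0 (s + D).
  have : s + D < ln (1 + nc w) by rewrite -[ltLHS]expRK ltr_ln ?posrE //; lra.
  by lra.
exists U; first by split.
move=> u Fu; have [k uk] := iterates_choice Fu.
have [[t ht kt]|[v [t ht kt]]] := subsequence_dichotomy k; last first.
  by apply: (@normal_constant _ u t (iter v (poly_map f))) => // j; rewrite uk kt.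
exists t => //; exists (fun=> None) => x Ux; exists U; first exact: open_nbhs_nbhs.
apply/uniform_cvgP => e e0.
have nB : nbhs (None : S) [set q | mdist (None : S) q < e].
  by rewrite -ballEmdist; exact: nbhsx_ballx.
have [Q HQ] := nbhs_None nB.
have [A A1 HA] := orb_bounds f2.
exists (Num.bound (A * (1 + `|Q|) / s)) => n Nn [w|] /= Uw; rewrite uk; last first.
  by rewrite iter_None mdistxx.
rewrite iter_Some; apply: HQ.
have A0 : 0 < A by lra.
have := archi_boundP (divr_ge0 (mulr_ge0 (ltW A0) (addr_ge0 ler01 (normr_ge0 Q))) (ltW s0)).
rewrite ltr_pdivrMr // => h.
have [_ h3] := HA (k (t n)) w.
have h4 := expR_ge1Dx (d ^+ k (t n) * green f w).
have h5 : (Num.bound (A * (1 + `|Q|) / s))%:R * s <= d ^+ k (t n) * green f w.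
  apply: ler_pM => //; [exact: ltW| |exact: ltW].
  rewrite -natrX ler_nat (leq_trans Nn) // (leq_trans (kt n)) //.
  by rewrite ltnW // ltn_expl.
have : A * (1 + `|Q|) < A * (1 + nc (orb f (k (t n)) w)) by lra.
by rewrite ltr_pM2l // ltrD2l; apply: le_lt_trans; exact: ler_norm.
Qed.

(** The iterates are bounded on [K_f]. *)
Lemma fatou_interior z (e : R) : 0 < e ->
  (forall w, nc (w - z) < e -> green f w = 0) -> fatou_set (poly_map f) (Some z).
Proof.
move=> e0 Hz; pose r := e / 5; have r0 : 0 < r by rewrite divr_gt0.
pose U := [set q : S | if q is Some w then nc (w - z) < r else False].
have oU : open U.
  rewrite openE => -[w|] //= Uq; apply: (@Some_nbhs _ _ _ (r - nc (w - z))).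
    by rewrite subr_gt0.
  by move=> v vw; rewrite /U /=; have := nc_dist_triangle w v z; lra.
exists U; first by split => //; rewrite /U /= subrr nc0.
move=> u Fu; have [k uk] := iterates_choice Fu.
have [A A1 HA] := orb_bounds f2.
have bnd n w : nc (w - z) <= 2 * (2 * r) -> nc (orb f n w) <= A.
  move=> wz; have [h _] := HA n w; move: h; rewrite Hz; last by rewrite /r in wz; lra.
  by rewrite mulr0 expR0 mulr1; have := nc_ge0 (orb f n w); lra.
have [|n w wz|n v w vz wz|t ht [l Hl]] :=
    @montel_extraction R (fun n => orb f (k n)) z r A (2 * A / (2 * r)) r0.
- by rewrite divr_ge0 //; lra.
- by apply: bnd; lra.
- rewrite -!horner_iter_poly; apply: bounded_poly_lipschitz vz wz; first lra.
  by move=> y /(bnd (k n)); rewrite horner_iter_poly.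
exists t => //; exists (fun q => if q is Some w then Some (l w) else None) => x Ux.
exists U; first exact: open_nbhs_nbhs.
apply/uniform_cvgP => eps eps0; have [a a0 Ha] := dist_of_chord eps0.
have [N HN] := Hl a a0; exists N => n Nn [w|//] /= Uw; rewrite uk iter_Some.
apply: Ha; apply: le_lt_trans (half_chord_Some _ _) _.
by rewrite nc_distC; apply: HN => //; exact: ltW.
Qed.

(** A uniform limit on a neighborhood would nearly coincide with one of the
    iterates, which is continuous at [z], while there are points close to [z]
    that escape to infinity and the orbit of [z] is bounded. *)
Lemma boundary_not_fatou z : green f z = 0 ->
  (forall e : R, 0 < e -> exists2 w, nc (w - z) < e & 0 < green f w) ->
  ~ fatou_set (poly_map f) (Some z).
Proof.
move=> Gz nlm [U [oU Uz] nU].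
have [|k hk [l Hl]] := nU (fun n => iter n.+1 (poly_map f)).
  by move=> n; exists n.+1.
have [V nV /uniform_cvgP cV] := Hl _ Uz.
have [M HM] : exists M : R, forall n, nc (orb f n z) <= M.
  exact/(filled_juliaP f2).
have [e e0 [Q HQ]] := mdist_Some_bound M.
have e5 : 0 < e / 5 by rewrite divr_gt0.
have [N HN] := cV (e / 5) e5.
have [r r0 HV] := nbhs_Some nV.
have [a a0 Ha] := dist_of_chord e5.
have [b b0 Hb] := poly_continuous_at (iter_poly f (k N).+1) z a0.
have [w wz Gw] := nlm (Num.min r b) ltac:(by rewrite lt_min r0 b0).
move: wz; rewrite lt_min => /andP[wr wb].
have Vw := HV w wr; have Vz : V (Some z) by apply: HV; rewrite subrr nc0.
have [N1 HN1] := orb_large f2 Q Gw.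
pose m := maxn N N1.
have km : (N1 <= (k m).+1)%N.
  rewrite ltnW // ltnS (leq_trans (leq_maxr N N1)) // -/m.
  by elim: m => // m IH; rewrite (leq_ltn_trans IH) // hk.
have h1 := HN N (leqnn N) _ Vw; have h2 := HN N (leqnn N) _ Vz.
have h3 := HN m (leq_maxl _ _) _ Vw; have h4 := HN m (leq_maxl _ _) _ Vz.
rewrite /comp !iter_Some in h1 h2 h3 h4.
have h5 : mdist (Some (orb f (k N).+1 w) : S) (Some (orb f (k N).+1 z)) < e / 5.
  apply: Ha; apply: le_lt_trans (half_chord_Some _ _) _.
  by have := Hb w wb; rewrite !horner_iter_poly.
have h6 := HQ (orb f (k m).+1 z) (orb f (k m).+1 w) (HM _) (HN1 _ km).
have := metric_triangle (Some (orb f (k m).+1 z) : S) (l (Some z)) (Some (orb f (k m).+1 w)).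
have := metric_triangle (l (Some z)) (Some (orb f (k N).+1 z) : S) (Some (orb f (k m).+1 w)).
have := metric_triangle (Some (orb f (k N).+1 z) : S) (Some (orb f (k N).+1 w)) (Some (orb f (k m).+1 w)).
have := metric_triangle (Some (orb f (k N).+1 w) : S) (l (Some w)) (Some (orb f (k m).+1 w)).
rewrite (metric_sym (Some (orb f (k m).+1 z) : S) (l _)).
rewrite (metric_sym (Some (orb f (k N).+1 w) : S) (l _)).
rewrite (metric_sym (Some (orb f (k N).+1 z) : S) (Some (orb f (k N).+1 w))).
lra.
Qed.

Lemma julia_setE : julia_set (poly_map f) = [set p : S | if p is Some z then
  green f z = 0 /\ (forall e : R, 0 < e -> exists2 w, nc (w - z) < e & 0 < green f w)
  else False].
Proof.
apply/seteqP; split => -[z|] /= H.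
- have Gz : green f z = 0.
    apply/eqP; rewrite eq_le green_ge0 // andbT leNgt; apply/negP => Gz.
    by apply: H; exact: fatou_escaping.
  split => // e e0; apply: contrapT => ne; apply: H.
  apply: (fatou_interior e0) => w wz; apply/eqP; rewrite eq_le green_ge0 // andbT leNgt.
  by apply/negP => Gw; apply: ne; exists w.
- by apply: H; exact: fatou_escaping.
- by case: H => Gz nlm; exact: boundary_not_fatou.
- by case: H.
Qed.

End JuliaSet.

(** * The smallest completely invariant closed set *)

Section Main.
Context {R : realType}.
Local Notation S := (riemann_sphere R).

Lemma two_finite_points (X : set S) : (`I_3 #<= X)%card ->
  exists x1 x2 : R[i], [/\ X (Some x1), X (Some x2) & x1 != x2].
Proof.
move=> /card_leP[h].
pose v n (n3 : `I_3 n) : S := \val (h (SigSub (mem_set n3))).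
have vX n (n3 : `I_3 n) : X (v n n3) by exact: set_valP.
have vI m n (m3 : `I_3 m) (n3 : `I_3 n) : v m m3 = v n n3 -> m = n.
  by move=> /val_inj /(@inj _ _ _ h); rewrite !inE => /(_ I I) [].
pose p0 : `I_3 0%N := isT; pose p1 : `I_3 1%N := isT; pose p2 : `I_3 2%N := isT.
have h0 := vX _ p0; have h1 := vX _ p1; have h2 := vX _ p2.
have := vI _ _ p0 p1; have := vI _ _ p0 p2; have := vI _ _ p1 p2.
move: h0 h1 h2; case: (v _ p0) => [a|]; case: (v _ p1) => [b|]; case: (v _ p2) => [c|] //= A B C H1 H2 H3.
- by exists a, b; split => //; apply/eqP => ab; have := H3 (congr1 Some ab).
- by exists a, b; split => //; apply/eqP => ab; have := H3 (congr1 Some ab).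
- by exists a, c; split => //; apply/eqP => ab; have := H2 (congr1 Some ab).
- by have := H1 erefl.
- by exists b, c; split => //; apply/eqP => ab; have := H1 (congr1 Some ab).
- by have := H2 erefl.
- by have := H3 erefl.
- by have := H1 erefl.
Qed.

Lemma two_points_open (X : set S) p : closed X -> ~ X p ->
  exists y1 y2 : R[i], [/\ ~ X (Some y1), ~ X (Some y2) & y1 != y2].
Proof.
move=> cX nXp; have oX : open (~` X) by exact: closed_openC.
have nX : nbhs p (~` X) by apply: open_nbhs_nbhs.
case: p nXp nX => [z|] nXp nX.
  have [r r0 Hr] := nbhs_Some nX.
  exists z, (z + ((r / 2)%:C)%C); split => //.
    by apply: (Hr (z + ((r / 2)%:C)%C)); rewrite addrC addKr ncR gtr0_norm; lra.
  by rewrite -subr_eq0 opprD addNKr oppr_eq0 -nc_gt0 ncR normr_gt0; lra.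
have [Q HQ] := nbhs_None nX.
have q0 : 0 <= `|Q| by []. have qQ := ler_norm Q.
exists ((`|Q| + 1)%:C)%C, ((`|Q| + 2)%:C)%C; split.
- by apply: HQ; rewrite ncR ger0_norm; lra.
- by apply: HQ; rewrite ncR ger0_norm; lra.
- by rewrite -subr_eq0 -rmorphB -nc_gt0 ncR normr_gt0; lra.
Qed.

End Main.

Theorem theorem1 (R : realType) (f g : {poly R[i]})
    (deg_f : (2 <= (size f).-1)%N) (deg_g : (2 <= (size g).-1)%N) :
  julia_set (poly_map f) <> julia_set (poly_map g) ->
  E_set (generated_semigroup [set poly_map f; poly_map g]) = [set: riemann_sphere R].
Proof.
move=> Jfg; apply/seteqP; split => // p _ X [Xcl Xinv X3]; apply: contrapT => nXp.
apply: Jfg; rewrite !julia_setE //.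
have [x1 [x2 [X1 X2 x12]]] := two_finite_points X3.
have [y1 [y2 [Y1 Y2 y12]]] := two_points_open Xcl nXp.
pose A : set R[i] := [set z | X (Some z)].
have inv h : [set poly_map f; poly_map g] (poly_map h) -> forall z, A z <-> A h.[z].
  move=> hG z; have [fw bw] := Xinv _ (gen_base hG); split => [Az|Az].
    by apply: fw; exists (Some z).
  exact: (bw (Some z)).
have Acl : nc_closed A.
  move=> z nAz; have nX : nbhs (Some z : riemann_sphere R) (~` X).
    by apply: open_nbhs_nbhs; split => //; exact: closed_openC.
  by have [r r0 Hr] := nbhs_Some nX; exists r.
have fg : forall z, green f z = 0 <-> green g z = 0.
  apply: (@filled_julia_eq R f g A x1 x2 y1 y2) => //.
  - by apply: inv; left.
  - by apply: inv; right.
have gt0 z : 0 < green f z <-> 0 < green g z.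
  rewrite !lt0r !green_ge0 // !andbT; split; apply: contraNN => /eqP h; apply/eqP.
    exact: (fg z).2.
  exact: (fg z).1.
apply/seteqP; split => -[z|//] [Gz nlm]; split.
- exact: (fg z).1.
- by move=> e /nlm[w wz Gw]; exists w => //; exact: (gt0 w).1.
- exact: (fg z).2.
- by move=> e /nlm[w wz Gw]; exists w => //; exact: (gt0 w).2.
Qed.
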